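(* Let $b^{\mathrm L},b^{\mathrm R}\in[0,1]$, let $\mathbf C=[c_{xy}]_{x,y\in\{1,2\}}$ be a $2\times2$ matrix with non-negative entries, and let $G_n$ be the random bipartite compatibility graph with parameters $(b^{\mathrm L},b^{\mathrm R},\mathbf C)$ on $n$ supply and $n$ demand nodes. Let $(p_1,p_2)=(1-b^{\mathrm L},b^{\mathrm L})$, $(q_1,q_2)=(1-b^{\mathrm R},b^{\mathrm R})$, $M_y=\sum_{x=1}^2c_{xy}p_x$, and $$F(t_1,t_2)=\sum_{x=1}^{2}p_x\exp\Big(-\sum_{y=1}^{2}c_{xy}\,q_y\,e^{-M_yt_y}\Big)+\sum_{y=1}^{2}q_y\,e^{-M_yt_y}(1+M_yt_y)-1 .$$ Then the asymptotic matching rate $\eta(b^{\mathrm L},b^{\mathrm R};\mathbf C)$ satisfies $$\eta(b^{\mathrm L},b^{\mathrm R};\mathbf C)=\lim_{n\to\infty}\frac{\mathbb E[M_\star(G_n)]}{n}=1-\max_{t_1,t_2\in[0,1]}F(t_1,t_2).$$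
   Context: Random compatibility graph $G_n$ with parameters $(b^{\mathrm L},b^{\mathrm R},\mathbf C)$: a bipartite graph with $n$ supply nodes and $n$ demand nodes. Independently over nodes, each supply node is of type 2 (flexible) with probability $b^{\mathrm L}$ and of type 1 (regular) otherwise, and each demand node is of type 2 with probability $b^{\mathrm R}$ and of type 1 otherwise. Conditional on all types, edges form independently: a supply node of type $x$ and a demand node of type $y$ are connected with probability $c_{xy}/n$ (with $n$ large enough that all these numbers are at most 1). $M_\star(G)$ denotes the size (number of edges) of a maximum matching in the graph $G$. The asymptotic matching rate is $\eta(b^{\mathrm L},b^{\mathrm R};\mathbf C)=\lim_{n\to\infty}\mathbb E[M_\star(G_n)]/n$. *)

(* Defs.v *)
From HB Require Import structures.
From mathcomp Require Import all_boot all_order all_algebra.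
From mathcomp Require Import all_classical all_reals all_analysis.

Set Implicit Arguments.
Unset Strict Implicit.
Unset Printing Implicit Defensive.

Import Order.TTheory GRing.Theory Num.Theory.
Import numFieldNormedType.Exports.

Local Open Scope classical_set_scope.
Local Open Scope ring_scope.

(** A bipartite graph with supply nodes [S] and demand nodes [D] is given by its
    edge set [E : {set S * D}]. *)
Definition is_matching (S D : finType) (E M : {set S * D}) : bool :=
  (M \subset E) &&
  [forall e in M, forall f in M, ((e.1 == f.1) || (e.2 == f.2)) ==> (e == f)].

Definition max_matching (S D : finType) (E : {set S * D}) : nat :=
  (\max_(M : {set S * D} | is_matching E M) #|M|)%N.

(** Node types are elements of ['I_2]: [0] is type 1 (regular) and [1] is type 2
    (flexible). *)
Definition type_prob (R : realType) (b : R) (x : 'I_2) : R :=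
  if x == 0 then 1 - b else b.

(** The truncation at 1 is active only for finitely many [n]; it makes
    [graph_prob] below a probability mass function for every [n]. *)
Definition edge_prob (R : realType) (C : 'M[R]_2) (n : nat) (x y : 'I_2) : R :=
  Num.min (C x y / n%:R) 1.

(** An outcome consists of the supply types, the demand types and the edges. *)
Definition outcome (n : nat) : finType :=
  ({ffun 'I_n -> 'I_2} * {ffun 'I_n -> 'I_2} * {set 'I_n * 'I_n})%type.

Definition graph_prob (R : realType) (bL bR : R) (C : 'M[R]_2) (n : nat)
    (w : outcome n) : R :=
  let: (s, d, E) := w in
  (\prod_(i < n) type_prob bL (s i)) * (\prod_(j < n) type_prob bR (d j)) *
  \prod_(e : 'I_n * 'I_n)
    (if e \in E then edge_prob C n (s e.1) (d e.2)
     else 1 - edge_prob C n (s e.1) (d e.2)).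

Definition expectation_graph (R : realType) (bL bR : R) (C : 'M[R]_2) (n : nat)
    (X : outcome n -> R) : R :=
  \sum_(w : outcome n) graph_prob bL bR C w * X w.

Definition mean_max_matching (R : realType) (bL bR : R) (C : 'M[R]_2)
    (n : nat) : R :=
  expectation_graph bL bR C (fun w : outcome n => (max_matching w.2)%:R).

Definition matching_rate (R : realType) (bL bR : R) (C : 'M[R]_2) : R :=
  limn (fun n : nat => mean_max_matching bL bR C n / n%:R).

Definition mean_demand_degree (R : realType) (bL : R) (C : 'M[R]_2)
    (y : 'I_2) : R :=
  \sum_(x < 2) C x y * type_prob bL x.

Definition F (R : realType) (bL bR : R) (C : 'M[R]_2) (t1 t2 : R) : R :=
  let p := type_prob bL in
  let q := type_prob bR in
  let M := mean_demand_degree bL C in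
  let t (y : 'I_2) := if y == 0 then t1 else t2 in
  \sum_(x < 2) p x * expR (- \sum_(y < 2) C x y * q y * expR (- (M y * t y))) +
  \sum_(y < 2) q y * expR (- (M y * t y)) * (1 + M y * t y) - 1.

Definition is_maximum (R : realType) (A : set R) (m : R) : Prop :=
  A m /\ ubound A m.

Lemma graph_prob_ge0 (R : realType) (bL bR : R) (C : 'M[R]_2) (n : nat)
    (w : outcome n) :
  0 <= bL <= 1 -> 0 <= bR <= 1 -> (forall x y, 0 <= C x y) ->
  0 <= graph_prob bL bR C w.
Proof.
move=> /andP[L0 L1] /andP[R0 R1] C0; case: w => [[s d] E] /=.
have tp b x : 0 <= b -> b <= 1 -> 0 <= @type_prob R b x.
  by rewrite /type_prob; case: ifP => // _ _; rewrite subr_ge0.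
rewrite !mulr_ge0 ?prodr_ge0// => [i _|i _|e _]; rewrite ?tp//.
case: ifP => _; last by rewrite subr_ge0 ge_min lexx orbT.
by rewrite le_min ler01 andbT divr_ge0.
Qed.

Lemma sum_graph_prob (R : realType) (bL bR : R) (C : 'M[R]_2) (n : nat) :
  \sum_(w : outcome n) graph_prob bL bR C w = 1.
Proof.
have tp b : \sum_(s : {ffun 'I_n -> 'I_2}) \prod_i @type_prob R b (s i) = 1.
  rewrite -(bigA_distr_bigA (fun _ x => type_prob b x)) big1// => i _.
  by rewrite big_ord_recl big_ord1 /type_prob /= subrK.
have ep (f : 'I_n * 'I_n -> R) : \sum_(E : {set 'I_n * 'I_n})
    \prod_e (if e \in E then f e else 1 - f e) = 1.
  transitivity (\prod_e (f e + (1 - f e))); first by rewrite bigA_distr.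
  by rewrite big1// => e _; rewrite addrC subrK.
transitivity (\sum_(sd : {ffun 'I_n -> 'I_2} * {ffun 'I_n -> 'I_2})
   \sum_(E : {set 'I_n * 'I_n}) graph_prob bL bR C (sd, E)).
  by rewrite [RHS]pair_bigA; apply: eq_bigr => -[].
transitivity (\sum_(s : {ffun 'I_n -> 'I_2}) \sum_(d : {ffun 'I_n -> 'I_2})
   (\prod_i type_prob bL (s i)) * \prod_j type_prob bR (d j)).
  rewrite [RHS]pair_bigA; apply: eq_bigr => -[s d] _ /=.
  by rewrite -mulr_sumr (ep (fun e => edge_prob C n (s e.1) (d e.2))) mulr1.
by under eq_bigr do rewrite -mulr_sumr tp mulr1; rewrite tp.
Qed.

(* Main.v *)
(** Give a supply set [A] the cost |complement of A| + #(demand nodes adjacent to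
    [A]). By König's theorem the matching number is the least cost, and the
    least set of least cost consists of the supply nodes that some maximum
    matching misses. A new demand node raises the matching number iff it is
    adjacent to that set; this is all that is used about matchings. Supply types
    are fixed throughout and averaged out at the end, so that the demand nodes
    are independent and identically distributed.

    Unmatched fraction >= F(t) for every t: replace the demand nodes one by one by
    pendant demand nodes, attached to a supply node of type x at the rate
    sum_y c_xy q_y exp (- M_y t_y). The derivative along this interpolation is
    bounded by the convexity of exp, through its tangent line at M_y t_y.

    Unmatched fraction <= max F: the mean matching number of l demand nodes is
    concave in l with increments in [0,1], so for some l close to n its second
    difference is small. The second difference is the probability that two
    new demand nodes are useful separately but not jointly. Up to this error,
    the cavity heuristics hold: the number of missed demand nodes of type y
    is close to n q_y exp (- z_y), where z_y is the mean number of missed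
    supply nodes adjacent to a new demand node of type y, and a demand node with
    two neighbours that are missed in its absence keeps a missed neighbour.
    The unmatched fraction is then at most the mean of the value of F at
    t_y = z_y / M_y, where z is random, hence at most max F. *)
Require Import Defs.
From mathcomp Require Import all_boot zify.

Set Implicit Arguments.
Unset Strict Implicit.
Unset Printing Implicit Defensive.

(** * Vertex covers of bipartite graphs *)

Section VertexCover.
Variable T : finType.
Implicit Types (G H : seq {set T}) (A B N X Y : {set T}) (u w : T).

Definition hits A N : bool := [exists u in N, u \in A].

Definition cover_cost G A : nat := #|~: A| + count (hits A) G.

Definition cover_number G : nat :=
  cover_cost G [arg min_(A < set0) cover_cost G A].

Definition optimal G A : bool := cover_cost G A == cover_number G.

(* Once [cover_number] is the matching number, [least_optimal G] consists of the
   supply nodes missed by some maximum matching, and a demand node of [G] is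
   missed by some maximum matching iff it does not hit [greatest_optimal G]. *)
Definition least_optimal G : {set T} :=
  [arg min_(A < [arg min_(A < set0) cover_cost G A] | optimal G A) #|A|].

Definition greatest_optimal G : {set T} :=
  [arg max_(A > [arg min_(A < set0) cover_cost G A] | optimal G A) #|A|].

Lemma hitsP A N : reflect (exists2 u, u \in N & u \in A) (hits A N).
Proof. exact: 'exists_in_idP. Qed.

Lemma hitsS A B N : A \subset B -> hits A N -> hits B N.
Proof. by move=> /subsetP sAB /hitsP[u uN /sAB uB]; apply/hitsP; exists u. Qed.

Lemma hits_set1 A u : hits A [set u] = (u \in A).
Proof.
apply/hitsP/idP => [[w /set1P ->]//|uA]; by exists u; rewrite ?set11.
Qed.

Lemma hitsU A B N : hits (A :|: B) N = hits A N || hits B N.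
Proof.
apply/hitsP/orP => [[u uN]|].
  by rewrite inE => /orP[uA|uB]; [left|right]; apply/hitsP; exists u.
by case=> /hitsP[u uN uX]; exists u => //; rewrite inE uX ?orbT.
Qed.

Lemma cover_cost_cons G A N : cover_cost (N :: G) A = cover_cost G A + hits A N.
Proof. by rewrite /cover_cost /=; lia. Qed.

Lemma eq_cover_cost G H : perm_eq G H -> cover_cost G =1 cover_cost H.
Proof. by move=> /permP GH A; rewrite /cover_cost GH. Qed.

(** The size of the complement is modular, and a demand node that hits [A :&: B] hits both [A] and
    [B]. *)
Lemma cover_cost_submod G A B :
  cover_cost G (A :|: B) + cover_cost G (A :&: B)
    <= cover_cost G A + cover_cost G B.
Proof.
elim: G => [|N G IH].
  rewrite /cover_cost /= !addn0 setCU setCI.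
  by have := cardsUI (~: A) (~: B); lia.
rewrite !cover_cost_cons hitsU.
have : hits (A :&: B) N -> hits A N && hits B N.
  by move=> AB; rewrite (hitsS (subsetIl _ _) AB) (hitsS (subsetIr _ _) AB).
by case: (hits (A :&: B) N) (hits A N) (hits B N) => [|] [|] [|] //= h;
  try (by move: (h isT)); lia.
Qed.

Lemma cover_number_le G A : cover_number G <= cover_cost G A.
Proof.
by rewrite /cover_number; case: arg_minnP => //= B _; apply.
Qed.

Lemma optimalP G A : reflect (forall B, cover_cost G A <= cover_cost G B) (optimal G A).
Proof.
apply: (iffP eqP) => [-> B|h]; first exact: cover_number_le.
by apply/eqP; rewrite eqn_leq cover_number_le h.
Qed.

Lemma optimal_arg G : optimal G [arg min_(A < set0) cover_cost G A].
Proof. exact: eqxx. Qed.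

(** By submodularity the optimal sets form a lattice; this is why an optimal set of least (greatest)
    cardinality is least (greatest) for inclusion. *)
Lemma optimalUI G A B :
  optimal G A -> optimal G B -> optimal G (A :|: B) /\ optimal G (A :&: B).
Proof.
rewrite /optimal => /eqP hA /eqP hB; have := cover_cost_submod G A B.
by have := cover_number_le G (A :|: B); have := cover_number_le G (A :&: B); lia.
Qed.

Lemma least_optimalP G :
  optimal G (least_optimal G) /\ forall A, optimal G A -> least_optimal G \subset A.
Proof.
rewrite /least_optimal; case: arg_minnP => [|A hA minA]; first exact: optimal_arg.
split=> // B hB; have [_ /minA hAB] := optimalUI hA hB.
by apply/setIidPl/eqP; rewrite eqEcard subsetIl.
Qed.

Lemma greatest_optimalP G :
  optimal G (greatest_optimal G) /\
  forall A, optimal G A -> A \subset greatest_optimal G.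
Proof.
rewrite /greatest_optimal; case: arg_maxnP => [|A hA maxA]; first exact: optimal_arg.
split=> // B hB; have [/maxA hAB _] := optimalUI hA hB.
by apply/setUidPl; apply/esym/eqP; rewrite eqEcard subsetUl.
Qed.

Lemma optimal_least G : optimal G (least_optimal G).
Proof. by case: (least_optimalP G). Qed.

Lemma optimal_greatest G : optimal G (greatest_optimal G).
Proof. by case: (greatest_optimalP G). Qed.

Lemma least_optimal_sub G A : optimal G A -> least_optimal G \subset A.
Proof. by case: (least_optimalP G) => _; apply. Qed.

Lemma greatest_optimal_sub G A : optimal G A -> A \subset greatest_optimal G.
Proof. by case: (greatest_optimalP G) => _; apply. Qed.

Lemma perm_cover_number G H : perm_eq G H -> cover_number G = cover_number H.
Proof.
move=> /eq_cover_cost GH; apply/eqP; rewrite eqn_leq.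
by rewrite {2}/cover_number -GH cover_number_le {2}/cover_number GH cover_number_le.
Qed.

Lemma perm_optimal G H : perm_eq G H -> optimal G =1 optimal H.
Proof. by move=> GH A; rewrite /optimal (eq_cover_cost GH) (perm_cover_number GH). Qed.

Lemma perm_least_optimal G H : perm_eq G H -> least_optimal G = least_optimal H.
Proof.
move=> GH; apply/eqP; rewrite eqEsubset !least_optimal_sub//.
  by rewrite -(perm_optimal GH) optimal_least.
by rewrite (perm_optimal GH) optimal_least.
Qed.

Lemma perm_greatest_optimal G H :
  perm_eq G H -> greatest_optimal G = greatest_optimal H.
Proof.
move=> GH; apply/eqP; rewrite eqEsubset !greatest_optimal_sub//.
  by rewrite (perm_optimal GH) optimal_greatest.
by rewrite -(perm_optimal GH) optimal_greatest.
Qed.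

(** If the least optimal set hits [N], so does every optimal set, and all other sets already cost at
    least one more. Otherwise the least optimal set keeps its cost. *)
Lemma cover_number_cons G N :
  cover_number (N :: G) = cover_number G + hits (least_optimal G) N.
Proof.
have /eqP hA := optimal_least G.
have /eqP hB := optimal_least (N :: G).
have le1 := cover_number_le (N :: G) (least_optimal G).
have le2 := cover_number_le G (least_optimal (N :: G)).
rewrite cover_cost_cons in le1; rewrite cover_cost_cons in hB.
have : cover_number G = cover_cost G (least_optimal (N :: G)) ->
    hits (least_optimal G) N -> hits (least_optimal (N :: G)) N.
  by move=> e; apply/hitsS/least_optimal_sub/eqP.
by case: (hits (least_optimal G) N) (hits _ N) hB le1 => [|] [|] /= hB le1 h; lia.
Qed.

Lemma least_optimal_cons_sub G N : least_optimal (N :: G) \subset least_optimal G.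
Proof.
apply: least_optimal_sub; rewrite /optimal cover_cost_cons cover_number_cons.
by rewrite (eqP (optimal_least G)).
Qed.

(** Such a node leaves the minimal cost unchanged, so every optimal set of [N :: G] is optimal for
    [G]. *)
Lemma least_optimal_cons_disjoint G N :
  ~~ hits (least_optimal G) N -> least_optimal (N :: G) = least_optimal G.
Proof.
move=> hN; apply/eqP; rewrite eqEsubset least_optimal_cons_sub least_optimal_sub//.
have /eqP := optimal_least (N :: G); rewrite cover_cost_cons cover_number_cons.
rewrite (negbTE hN) /optimal addn0 => h; apply/eqP.
by have := cover_number_le G (least_optimal (N :: G)); lia.
Qed.

(** Whether a demand node can be missed is thus decided by the graph without it. If [N] hits the
    least optimal set of [G], that set stays optimal; otherwise the minimal cost is unchanged, and
    an optimal set hitting [N] would cost less than the minimum in [G]. *)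
Lemma hits_greatest_optimal G N :
  hits (greatest_optimal (N :: G)) N = hits (least_optimal G) N.
Proof.
have [hN|hN] := boolP (hits (least_optimal G) N).
  apply: (hitsS _ hN); apply: greatest_optimal_sub.
  by rewrite /optimal cover_cost_cons cover_number_cons (eqP (optimal_least G)).
apply/negbTE/negP => hg; have /eqP := optimal_greatest (N :: G).
rewrite cover_cost_cons cover_number_cons (negbTE hN) hg.
by have := cover_number_le G (greatest_optimal (N :: G)); lia.
Qed.

Lemma cover_number_le_card G : cover_number G <= #|T|.
Proof.
apply: leq_trans (cover_number_le G set0) _; rewrite /cover_cost setC0 cardsT.
suff -> : count (hits set0) G = 0 by rewrite addn0.
by apply/eqP; rewrite -leqn0 leqNgt -has_count; apply/hasPn => N _;
  apply/hitsP => -[u _]; rewrite inE.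
Qed.

Lemma deficiencyE G :
  #|T| - cover_number G + count (hits (least_optimal G)) G = #|least_optimal G|.
Proof.
have /eqP h := optimal_least G; have hT := cover_number_le_card G.
by have := cardsC (least_optimal G); rewrite /cover_cost in h; lia.
Qed.

(* Two neighbours of [N] that are jointly useful survive the insertion of [N],
   because optimal sets of [N :: G] are optimal for [[set w] :: G]. *)
Lemma least_optimal_cons_hits G N u w :
    u \in N -> w \in N -> w \in least_optimal G ->
    u \in least_optimal ([set w] :: G) ->
  hits (least_optimal (N :: G)) N.
Proof.
move=> uN wN wA uA; apply/hitsP; exists u => //.
have mN : hits (least_optimal G) N by apply/hitsP; exists w.
suff /least_optimal_sub/subsetP/(_ _ uA) : optimal ([set w] :: G) (least_optimal (N :: G)) by [].
have /eqP := optimal_least (N :: G).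
have := cover_number_le ([set w] :: G) (least_optimal (N :: G)).
rewrite /optimal !cover_cost_cons !cover_number_cons mN !hits_set1 wA.
have : w \in least_optimal (N :: G) -> hits (least_optimal (N :: G)) N.
  by move=> h; apply/hitsP; exists w.
by case: (w \in least_optimal (N :: G)) (hits _ N) => [|] [|] // h; lia.
Qed.

(** * Isolating a supply node *)

Definition isolate u G : seq {set T} := [seq N :\ u | N <- G].

Lemma cover_cost_isolate u G A : cover_cost (isolate u G) A <= cover_cost G A.
Proof.
rewrite /cover_cost leq_add2l count_map; apply: sub_count => N /=.
by move=> /hitsP[w]; rewrite in_setD1 => /andP[_ wN] wA; apply/hitsP; exists w.
Qed.

Lemma hits_setD1 u A N : u \notin A -> hits A (N :\ u) = hits A N.
Proof.
move=> uA; apply/hitsP/hitsP => -[w wN wA]; exists w => //.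
  by move: wN; rewrite in_setD1 => /andP[].
by rewrite in_setD1 wN andbT; apply: contraNneq uA => <-.
Qed.

Lemma hits_isolate_setU1 u A N : hits (u |: A) (N :\ u) = hits A (N :\ u).
Proof.
rewrite hitsU; suff -> : hits [set u] (N :\ u) = false by [].
by apply/hitsP => -[w]; rewrite in_setD1 => /andP[wu _]; rewrite in_set1 (negbTE wu).
Qed.

Lemma cover_cost_isolate_notin u G A :
  u \notin A -> cover_cost (isolate u G) A = cover_cost G A.
Proof.
move=> uA; rewrite /cover_cost count_map; congr (_ + _); apply: eq_count => N /=.
exact: hits_setD1.
Qed.

Lemma cover_cost_isolate_setU1 u G A :
  u \notin A -> (cover_cost (isolate u G) (u |: A)).+1 = cover_cost (isolate u G) A.
Proof.
move=> uA; rewrite /cover_cost !count_map -addSn; congr (_ + _).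
  by have := cardsC (u |: A); have := cardsC A; rewrite cardsU1 uA; lia.
by apply: eq_count => N /=; rewrite hits_isolate_setU1.
Qed.

Lemma mem_optimal_isolate u G A : optimal (isolate u G) A -> u \in A.
Proof.
move=> /optimalP h; apply: contraT => /(cover_cost_isolate_setU1 G) e.
by have := h (u |: A); rewrite -e ltnn.
Qed.

(** Isolating a node of the least optimal set does not lower the minimal cost. So this set remains
    optimal at the same cost, and every demand node that hits it still does so through a neighbour
    other than [u]. *)
Lemma hits_greatest_isolate u G N :
    u \in least_optimal G -> N \in G -> u \in N ->
  hits (greatest_optimal (isolate u G)) (N :\ u).
Proof.
move=> uA NG uN; set A := least_optimal G in uA *.
have oA : optimal G A by exact: optimal_least.
have oA' := oA; rewrite /optimal in oA'.
pose Y := greatest_optimal (isolate u G).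
have oY : optimal (isolate u G) Y by exact: optimal_greatest.
have uY := mem_optimal_isolate oY.
(* Otherwise [Y :\ u], which costs one more than [Y] in the isolated graph, would be optimal for [G]
   without containing [u]. *)
have le0 : cover_cost G A <= cover_cost (isolate u G) Y.
  have uY' : u \notin Y :\ u by rewrite setD11.
  have := cover_cost_isolate_setU1 G uY'; rewrite setD1K// => e.
  rewrite (cover_cost_isolate_notin G uY') in e.
  rewrite -ltnS e ltnNge; apply/negP => le.
  have /least_optimal_sub : optimal G (Y :\ u).
    by apply/optimalP => B; apply: leq_trans le _; exact/optimalP.
  by move=> /subsetP/(_ u uA); rewrite setD11.
have le1 := cover_cost_isolate u G A.
have oA0 : optimal (isolate u G) A.
  apply/optimalP => B; apply: leq_trans le1 _; apply: leq_trans le0 _.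
  exact/optimalP.
apply: (hitsS (greatest_optimal_sub oA0)).
have : count (hits A) (isolate u G) = count (hits A) G.
  move/optimalP : oY => /(_ A) le2.
  have : cover_cost (isolate u G) A = cover_cost G A by lia.
  by rewrite /cover_cost => /eqP; rewrite eqn_add2l => /eqP.
rewrite count_map => e; apply: contraT => hN.
suff : count (preim (fun N => N :\ u) (hits A)) G < count (hits A) G by rewrite e ltnn.
have /permP pG := perm_to_rem NG; rewrite !pG /=.
have -> : hits A N by apply/hitsP; exists u.
rewrite (negbTE hN) add0n add1n ltnS; apply: sub_count => X /=.
by move=> /hitsP[w]; rewrite in_setD1 => /andP[_ wX] wA; apply/hitsP; exists w.
Qed.

(** [Y :\ u] lies in [Z] because its union with [Z] is optimal for [G]. Submodularity gives this,
    applied in [G] if [u] is outside [Z] and in the isolated graph otherwise. *)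
Lemma greatest_isolate_sub u G N :
  hits (greatest_optimal (isolate u G)) (N :\ u) -> hits (greatest_optimal G) N.
Proof.
pose Z := greatest_optimal G; pose Y := greatest_optimal (isolate u G).
suff sYZ : Y :\ u \subset Z.
  move=> /hitsP[w]; rewrite in_setD1 => /andP[wu wN] wY.
  apply/hitsP; exists w => //; apply: (subsetP sYZ).
  by rewrite in_setD1 wu.
have oY : optimal (isolate u G) Y by exact: optimal_greatest.
have uY := mem_optimal_isolate oY.
have /optimalP oZ : optimal G Z by exact: optimal_greatest.
have [uZ|uZ] := boolP (u \in Z); last first.
  apply: subset_trans (subsetUr Z _) _; apply: greatest_optimal_sub.
  apply/optimalP => B; apply: leq_trans (oZ B).
  have := cover_cost_submod G Z (Y :\ u).
  (* Both sets avoid [u]; once [u] is added to each, this is the optimality of [Y] in the isolated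
     graph. *)
  suff : cover_cost G (Y :\ u) <= cover_cost G (Z :&: (Y :\ u)) by lia.
  have uY' : u \notin Y :\ u by rewrite setD11.
  have uI : u \notin Z :&: (Y :\ u) by rewrite inE (negbTE uZ).
  rewrite -!(cover_cost_isolate_notin G uY') -!(cover_cost_isolate_notin G uI).
  rewrite -(cover_cost_isolate_setU1 G uY') -(cover_cost_isolate_setU1 G uI) setD1K//.
  by rewrite ltnS; exact/optimalP.
apply: subset_trans (subsetDl _ _) _.
apply: subset_trans (subsetUr Z _) _; apply: greatest_optimal_sub.
apply/optimalP => B; apply: leq_trans (oZ B).
have := cover_cost_submod (isolate u G) Z Y.
have /optimalP/(_ (Z :&: Y)) le1 := oY.
(* Restoring the edges of [u] raises the cost of [Z :|: Y] by no more than that of [Z]: a demand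
   node adjacent to [u] hits [Z] already. *)
have cnt : count (hits (Z :|: Y)) G + count (hits Z) (isolate u G)
    <= count (hits Z) G + count (hits (Z :|: Y)) (isolate u G).
  rewrite !count_map; elim: (G) => //= X H IH.
  suff : hits (Z :|: Y) X + hits Z (X :\ u) <= hits Z X + hits (Z :|: Y) (X :\ u).
    by lia.
  have [uN|uN] := boolP (u \in X).
    have mZ : hits Z X by apply/hitsP; exists u.
    rewrite mZ (hitsS (subsetUl _ _) mZ).
    by case: (boolP (hits Z (X :\ u))) => // /(hitsS (subsetUl Z Y)) ->.
  have -> : X :\ u = X by apply/setDidPl; rewrite disjoint_sym disjoints1.
  by rewrite addnC.
by move: le1; rewrite /cover_cost; lia.
Qed.

End VertexCover.

From HB Require Import structures.
From mathcomp Require Import all_order all_algebra ring lra.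
From mathcomp Require Import all_classical all_reals all_analysis.

Import Order.TTheory GRing.Theory Num.Theory.
Import numFieldNormedType.Exports.

(** * Expectations over independent samples *)

Section Mean.
Local Open Scope ring_scope.
Variables (R : realFieldType) (V : finType).
Implicit Types (P g h : V -> R) (phi psi : seq V -> R) (l : nat).

Definition distribution P : Prop := (forall v, 0 <= P v) /\ \sum_v P v = 1.

Definition mean P g : R := \sum_v P v * g v.

(** Samples are sequences, so that one more independent draw is a [cons] and the recursions for
    vertex covers apply under the mean. *)
Fixpoint mean_seq P l phi : R :=
  if l is l'.+1 then mean P (fun v => mean_seq P l' (fun w => phi (v :: w)))
  else phi [::].

Lemma eq_mean P g h : g =1 h -> mean P g = mean P h.
Proof. by move=> gh; apply: eq_bigr => v _; rewrite gh. Qed.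

Lemma meanD P g h : mean P (fun v => g v + h v) = mean P g + mean P h.
Proof. by rewrite -big_split; apply: eq_bigr => v _; rewrite mulrDr. Qed.

Lemma meanZ P a g : mean P (fun v => a * g v) = a * mean P g.
Proof. by rewrite /mean mulr_sumr; apply: eq_bigr => v _; rewrite mulrCA. Qed.

Lemma meanB P g h : mean P (fun v => g v - h v) = mean P g - mean P h.
Proof. by rewrite -sumrB; apply: eq_bigr => v _; rewrite mulrBr. Qed.

Lemma mean_sum P (I : Type) (r : seq I) (Q : pred I) (g : I -> V -> R) :
  mean P (fun v => \sum_(i <- r | Q i) g i v) = \sum_(i <- r | Q i) mean P (g i).
Proof. by rewrite exchange_big; apply: eq_bigr => v _; rewrite mulr_sumr. Qed.

Lemma mean_cst P a : distribution P -> mean P (fun=> a) = a.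
Proof. by case=> _ P1; rewrite /mean -mulr_suml P1 mul1r. Qed.

Lemma le_mean P g h : distribution P -> (forall v, g v <= h v) ->
  mean P g <= mean P h.
Proof. by case=> P0 _ gh; apply: ler_sum => v _; rewrite ler_wpM2l. Qed.

Lemma mean_ge0 P g : distribution P -> (forall v, 0 <= g v) -> 0 <= mean P g.
Proof. by move=> dP g0; rewrite -(mean_cst 0 dP); exact: le_mean. Qed.

Lemma eq_mean_seq P l phi psi : (forall w, size w = l -> phi w = psi w) ->
  mean_seq P l phi = mean_seq P l psi.
Proof.
elim: l phi psi => [|l IH] phi psi e /=; first exact: e.
by apply: eq_mean => v; apply: IH => w sw; apply: e; rewrite /= sw.
Qed.

Lemma mean_seqD P l phi psi :
  mean_seq P l (fun w => phi w + psi w) = mean_seq P l phi + mean_seq P l psi.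
Proof.
elim: l phi psi => [//|l IH] phi psi /=.
by rewrite -meanD; apply: eq_mean => v; rewrite IH.
Qed.

Lemma mean_seqZ P l a phi :
  mean_seq P l (fun w => a * phi w) = a * mean_seq P l phi.
Proof.
elim: l phi => [//|l IH] phi /=.
by rewrite -meanZ; apply: eq_mean => v; rewrite IH.
Qed.

Lemma mean_seqN P l phi : mean_seq P l (fun w => - phi w) = - mean_seq P l phi.
Proof.
by rewrite -mulN1r -mean_seqZ; apply: eq_mean_seq => w _; rewrite mulN1r.
Qed.

Lemma mean_seqB P l phi psi :
  mean_seq P l (fun w => phi w - psi w) = mean_seq P l phi - mean_seq P l psi.
Proof. by rewrite mean_seqD mean_seqN. Qed.

Lemma mean_seq_sum P l (I : Type) (r : seq I) (Q : pred I) (g : I -> seq V -> R) :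
  mean_seq P l (fun w => \sum_(i <- r | Q i) g i w) =
  \sum_(i <- r | Q i) mean_seq P l (g i).
Proof.
elim: l g => [//|l IH] g /=.
by rewrite -mean_sum; apply: eq_mean => v; rewrite IH.
Qed.

Lemma mean_seq_cst P l a : distribution P -> mean_seq P l (fun=> a) = a.
Proof.
move=> dP; elim: l => [//|l IH] /=.
by rewrite -[RHS](mean_cst a dP); apply: eq_mean.
Qed.

Lemma le_mean_seq P l phi psi : distribution P ->
  (forall w, size w = l -> phi w <= psi w) -> mean_seq P l phi <= mean_seq P l psi.
Proof.
move=> dP; elim: l phi psi => [|l IH] phi psi e /=; first exact: e.
by apply: le_mean => // v; apply: IH => w sw; apply: e; rewrite /= sw.
Qed.

Lemma mean_seq_ge0 P l phi : distribution P -> (forall w, 0 <= phi w) ->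
  0 <= mean_seq P l phi.
Proof. by move=> dP h; rewrite -(mean_seq_cst l 0 dP); exact: le_mean_seq. Qed.

Lemma le_mean_seqS P l phi : distribution P -> (forall v w, phi w <= phi (v :: w)) ->
  mean_seq P l phi <= mean_seq P l.+1 phi.
Proof.
move=> dP h; rewrite /= -[leLHS](mean_cst _ dP).
by apply: le_mean => // v; apply: le_mean_seq.
Qed.

Lemma ge_mean_seqS P l phi : distribution P -> (forall v w, phi (v :: w) <= phi w) ->
  mean_seq P l.+1 phi <= mean_seq P l phi.
Proof.
move=> dP h; rewrite /= -[leRHS](mean_cst _ dP).
by apply: le_mean => // v; apply: le_mean_seq.
Qed.

Lemma mean_seq_mean P l (g : V -> seq V -> R) :
  mean_seq P l (fun w => mean P (fun v => g v w)) =
  mean P (fun v => mean_seq P l (g v)).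
Proof. by rewrite mean_seq_sum; apply: eq_bigr => v _; rewrite mean_seqZ. Qed.

Lemma mean_seqS P l phi :
  mean_seq P l.+1 phi = mean_seq P l (fun w => mean P (fun v => phi (v :: w))).
Proof. by rewrite mean_seq_mean. Qed.

(** The hypothesis says that [a] and [b] have the same conditional mean given [del v]. The draws are
    independent, so the factors can be exchanged one at a time while [psi] sees the sample only
    through [del]. *)
Lemma mean_seq_resample P (del : V -> V) (a b : V -> R) l psi :
  (forall g, mean P (fun v => g (del v) * a v) = mean P (fun v => g (del v) * b v)) ->
  mean_seq P l (fun w => psi (map del w) * \prod_(v <- w) a v) =
  mean_seq P l (fun w => psi (map del w) * \prod_(v <- w) b v).
Proof.
move=> ab; elim: l psi => [|l IH] psi /=; first by rewrite !big_nil.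
transitivity (mean P (fun v => mean_seq P l (fun w =>
    psi (del v :: map del w) * \prod_(v <- w) b v) * a v)).
  apply: eq_mean => v; rewrite -(IH (fun w => psi (del v :: w))) mulrC -mean_seqZ.
  by apply: eq_mean_seq => w _; rewrite big_cons mulrCA.
rewrite (ab (fun d => mean_seq P l (fun w => psi (d :: map del w) * \prod_(v <- w) b v))).
apply: eq_mean => v; rewrite mulrC -mean_seqZ.
by apply: eq_mean_seq => w _; rewrite big_cons mulrCA.
Qed.

(** The parameter of the factors is a function of [map del w] with finitely many values; on each
    event [Z (map del w) == z] it is frozen and the previous lemma applies. *)
Lemma mean_seq_resample_fin (X : finType) P (del : V -> V) (a b : X -> V -> R)
    (Z : seq V -> X) l :
  (forall z g, mean P (fun v => g (del v) * a z v) = mean P (fun v => g (del v) * b z v)) ->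
  mean_seq P l (fun w => \prod_(v <- w) a (Z (map del w)) v) =
  mean_seq P l (fun w => \prod_(v <- w) b (Z (map del w)) v).
Proof.
move=> ab.
have e (d : X -> V -> R) : mean_seq P l (fun w => \prod_(v <- w) d (Z (map del w)) v) =
    \sum_z mean_seq P l (fun w => (Z (map del w) == z)%:R * \prod_(v <- w) d z v).
  rewrite -mean_seq_sum; apply: eq_mean_seq => w _.
  rewrite (bigD1 (Z (map del w)))//= eqxx mul1r [X in _ + X]big1 ?addr0// => z.
  by rewrite eq_sym => /negbTE ->; rewrite mul0r.
rewrite !e; apply: eq_bigr => z _.
exact: (mean_seq_resample l (fun w => (Z w == z)%:R) (ab z)).
Qed.

Fixpoint splits (w : seq V) : seq (V * seq V) :=
  if w is v :: w' then (v, w') :: [seq (p.1, v :: p.2) | p <- splits w'] else [::].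

Lemma mean_seq_splits P l (g : V -> seq V -> R) :
  mean_seq P l.+1 (fun w => \sum_(p <- splits w) g p.1 p.2) =
  l.+1%:R * mean P (fun v => mean_seq P l (g v)).
Proof.
elim: l g => [|l IH] g.
  rewrite mul1r; apply: eq_mean => v /=; exact: big_seq1.
transitivity (mean P (fun v => mean_seq P l.+1 (g v)) +
    mean P (fun x => mean_seq P l.+1 (fun w => \sum_(p <- splits w) g p.1 (x :: p.2)))).
  rewrite -meanD /=; apply: eq_mean => v; rewrite -[RHS]meanD /=.
  apply: eq_mean => x; rewrite -mean_seqD; apply: eq_mean_seq => w _ /=.
  by rewrite !big_cons big_map /= big_map.
rewrite -[l.+2]addn1 natrD mulrDl mul1r addrC; congr (_ + _).
under eq_mean do rewrite (IH (fun y r => g y (_ :: r))).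
rewrite meanZ; congr (_ * _); rewrite /mean /=.
under eq_bigr do rewrite mulr_sumr.
rewrite exchange_big; apply: eq_bigr => v _; rewrite mulr_sumr.
by apply: eq_bigr => x _; rewrite mulrCA.
Qed.

Lemma sum_splits (g : V -> seq V -> R) w :
  (forall v w1 w2, perm_eq w1 w2 -> g v w1 = g v w2) ->
  \sum_(v <- w) g v w = \sum_(p <- splits w) g p.1 (p.1 :: p.2).
Proof.
elim: w g => [|x w IH] g gp; first by rewrite !big_nil.
rewrite !big_cons big_map; congr (_ + _).
rewrite (IH (fun v w => g v (x :: w))); last first.
  by move=> v w1 w2 w12; apply: gp; rewrite perm_cons.
apply: eq_bigr => -[v r] _ /=; apply: gp.
by rewrite -[x :: v :: r]/([:: x; v] ++ r) -[v :: x :: r]/([:: v; x] ++ r)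
  perm_cat2r (perm_catC [:: x] [:: v]).
Qed.

(** A Mecke formula for samples of fixed size: the draws are exchangeable, so each of them may be
    moved to the front. *)
Lemma mean_seq_sum_mem P l (g : V -> seq V -> R) :
  (forall v w1 w2, perm_eq w1 w2 -> g v w1 = g v w2) ->
  mean_seq P l.+1 (fun w => \sum_(v <- w) g v w) =
  l.+1%:R * mean P (fun v => mean_seq P l (fun r => g v (v :: r))).
Proof.
move=> gp; rewrite -mean_seq_splits; apply: eq_mean_seq => w _.
exact: sum_splits.
Qed.

Lemma mean_seq_tuple P n phi :
  \sum_(t : n.-tuple V) (\prod_(v <- t) P v) * phi t = mean_seq P n phi.
Proof.
elim: n phi => [|n IH] phi /=.
  rewrite (big_pred1 [tuple]) ?big_nil ?mul1r// => t.
  by rewrite [t]tuple0; apply/esym/eqP.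
pose h (p : V * n.-tuple V) : n.+1.-tuple V := [tuple of p.1 :: p.2].
rewrite (reindex h) /=; last first.
  exists (fun t => (thead t, [tuple of behead t])) => [[v t] _|t _].
    by congr (_, _); apply: val_inj.
  by rewrite /h /=; case/tupleP: t => v t; apply: val_inj.
rewrite -(pair_bigA _ (fun v t => (\prod_(x <- h (v, t)) P x) * phi (h (v, t)))) /=.
apply: eq_bigr => v _; rewrite -IH mulr_sumr; apply: eq_bigr => t _.
by rewrite big_cons mulrA.
Qed.

(** The link with the sums over finite functions in the definition of the random graph. *)
Lemma mean_seq_ffun P n phi :
  \sum_(f : {ffun 'I_n -> V}) (\prod_i P (f i)) * phi [seq f i | i <- enum 'I_n]
  = mean_seq P n phi.
Proof.
rewrite -mean_seq_tuple.
rewrite (reindex (fun t : n.-tuple V => [ffun i => tnth t i])) /=; last first.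
  exists (fun f : {ffun 'I_n -> V} => [tuple f i | i < n]) => [t _|f _].
    by apply: eq_from_tnth => i; rewrite tnth_mktuple ffunE.
  by apply/ffunP => i; rewrite ffunE tnth_mktuple.
apply: eq_bigr => t _; congr (_ * phi _).
  by rewrite big_tuple; apply: eq_bigr => i _; rewrite ffunE.
by rewrite -[RHS]map_tnth_enum; apply: eq_map => i; rewrite ffunE.
Qed.

End Mean.

Lemma mean_seq_exchange (R : realFieldType) (U V : finType) (P : V -> R) (Q : U -> R)
    l (g : U -> seq V -> R) :
  (mean_seq P l (fun w => mean Q (fun u => g u w)) = mean Q (fun u => mean_seq P l (g u)))%R.
Proof. by rewrite mean_seq_sum; apply: eq_bigr => u _; rewrite mean_seqZ. Qed.

Lemma mean_seq_prod (R : realFieldType) (V : finType) (P : V -> R) l (g : V -> R) :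
  (mean_seq P l (fun w => \prod_(v <- w) g v) = mean P g ^+ l)%R.
Proof.
elim: l => [|l IH] /=; first by rewrite big_nil.
transitivity (mean P (fun v => mean P g ^+ l * g v))%R.
  apply: eq_mean => v; rewrite -IH mulrC -mean_seqZ.
  by apply: eq_mean_seq => w _; rewrite big_cons.
by rewrite meanZ -exprSr.
Qed.

(** * Random neighbourhoods *)

Section RandomSet.
Local Open Scope ring_scope.
Variables (R : realType) (T : finType) (a : T -> R).
Hypothesis a01 : forall u, 0 <= a u <= 1.
Implicit Types (A N : {set T}) (u w : T).

Definition random_set N : R := \prod_u (if u \in N then a u else 1 - a u).

Definition miss A : R := \prod_(u in A) (1 - a u).

Lemma random_set_prod (h : T -> bool -> R) :
  \sum_N random_set N * \prod_u h u (u \in N) =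
  \prod_u (a u * h u true + (1 - a u) * h u false).
Proof.
rewrite bigA_distr; apply: eq_bigr => N _; rewrite -big_split.
by apply: eq_bigr => u _ /=; case: ifP.
Qed.

Lemma random_set_distribution : distribution random_set.
Proof.
split=> [N|].
  apply: prodr_ge0 => u _; have /andP[] := a01 u.
  by case: ifP => // _ _; rewrite subr_ge0.
transitivity (\sum_N random_set N * \prod_(u : T) 1).
  by apply: eq_bigr => N _; rewrite big1 ?mulr1.
rewrite (random_set_prod (fun _ _ => 1)) big1// => u _.
by rewrite !mulr1 addrC subrK.
Qed.

Lemma mean_hitsN A : mean random_set (fun N => (~~ hits A N)%:R) = miss A.
Proof.
transitivity (\sum_N random_set N * \prod_u ((u \in A) ==> (u \notin N))%:R).
  apply: eq_bigr => N _; congr (_ * _).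
  case: (boolP (hits A N)) => [/hitsP[u uN uA]|hN].
    by rewrite (bigD1 u)//= uA uN mul0r.
  rewrite big1// => u _; case: implyP => // -[] uA; apply: contra hN => uN.
  by apply/hitsP; exists u.
rewrite (random_set_prod (fun u b => ((u \in A) ==> ~~ b)%:R)) /miss [RHS]big_mkcond.
apply: eq_bigr => u _; case: (u \in A) => /=; first by rewrite mulr0 mulr1 add0r.
by rewrite !mulr1 addrC subrK.
Qed.

Lemma mean_hits_once A u : u \in A ->
  mean random_set (fun N => ((u \in N) && ~~ hits (A :\ u) N)%:R) =
  a u * miss (A :\ u).
Proof.
move=> uA.
pose h w (b : bool) : R := if w == u then b%:R else ((w \in A) ==> ~~ b)%:R.
transitivity (\sum_N random_set N * \prod_w h w (w \in N)).
  apply: eq_bigr => N _; congr (_ * _).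
  rewrite (bigD1 u)//= /h eqxx; case: (u \in N); last by rewrite mul0r.
  rewrite mul1r /=; case: (boolP (hits _ N)) => [/hitsP[w wN]|hN].
    by rewrite in_setD1 => /andP[wu wA]; rewrite (bigD1 w)//= (negbTE wu) wA wN mul0r.
  rewrite big1// => w wu; rewrite (negbTE wu).
  case: implyP => // -[] wA; apply: contra hN => wN.
  by apply/hitsP; exists w => //; rewrite in_setD1 wu.
rewrite random_set_prod (bigD1 u)//= /h eqxx mulr1 mulr0 addr0; congr (_ * _).
rewrite /miss big_mkcond [RHS]big_mkcond; apply: eq_bigr => w _.
rewrite in_setD1; case: (w == u) => //=.
by case: (w \in A) => /=; rewrite ?mulr0 ?mulr1 ?add0r // addrC subrK.
Qed.

Lemma mean_mem2 u w : u != w ->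
  mean random_set (fun N => ((u \in N) && (w \in N))%:R) = a u * a w.
Proof.
move=> uw.
pose h v (b : bool) : R := if (v == u) || (v == w) then b%:R else 1.
transitivity (\sum_N random_set N * \prod_v h v (v \in N)).
  apply: eq_bigr => N _; congr (_ * _).
  rewrite (bigD1 u)//= (bigD1 w) 1?eq_sym//= /h !eqxx orbT /=.
  rewrite big1 ?mulr1 => [|v /andP[vu vw]]; last by rewrite (negbTE vu) (negbTE vw).
  by case: (u \in N); case: (w \in N); rewrite ?mulr0 ?mul0r ?mulr1.
rewrite random_set_prod (bigD1 u)//= (bigD1 w) 1?eq_sym//= /h !eqxx orbT /=.
rewrite big1 ?mulr1 ?mulr0 ?addr0// => v /andP[vu vw].
by rewrite (negbTE vu) (negbTE vw) !mulr1 addrC subrK.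
Qed.

(** The sum is grouped into pairs [N], [u |: N], on which [N :\ u] is constant; this is the
    independence of the edge at [u] from the other edges. *)
Lemma mean_setD1 u (g : {set T} -> R) :
  mean random_set (fun N => g (N :\ u) * (u \notin N)%:R) =
  mean random_set (fun N => g (N :\ u) * (1 - a u)).
Proof.
pose W := \sum_(N : {set T} | u \notin N)
   (\prod_(w | w != u) (if w \in N then a w else 1 - a w)) * g N.
have splitE (c : {set T} -> R) : mean random_set (fun N => g (N :\ u) * c N) =
    \sum_(N : {set T} | u \notin N)
      (\prod_(w | w != u) (if w \in N then a w else 1 - a w)) * g N
       * (a u * c (u |: N) + (1 - a u) * c N).
  rewrite /mean (bigID (fun N : {set T} => u \notin N)) /=.
  under [X in _ + X]eq_bigl do rewrite negbK.
  rewrite [X in _ + X](reindex_onto (fun N => u |: N) (fun N => N :\ u)) /=; last first.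
    by move=> N uN; rewrite finset.setD1K.
  rewrite [X in _ + X](eq_bigl (fun N : {set T} => u \notin N)); last first.
    move=> N; rewrite finset.setU11 /=; apply/eqP/idP => [<-|uN]; first by rewrite finset.setD11.
    by rewrite finset.setU1K.
  rewrite -big_split; apply: eq_bigr => N uN /=.
  have -> : (u |: N) :\ u = N by rewrite finset.setU1K.
  have -> : N :\ u = N.
    by apply/finset.setDidPl; rewrite disjoint_sym finset.disjoints1.
  rewrite /random_set (bigD1 u)//= (negbTE uN).
  rewrite [X in _ + X * _](bigD1 u)//= finset.setU11.
  rewrite [X in _ + _ * X * _](eq_bigr (fun w => if w \in N then a w else 1 - a w)).
    by ring.
  by move=> w wu; rewrite finset.in_setU1 (negbTE wu).
rewrite !splitE; apply: eq_bigr => N uN.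
rewrite finset.setU11 uN /=; ring.
Qed.

Lemma miss_ge0 A : 0 <= miss A.
Proof. by apply: prodr_ge0 => u _; have /andP[] := a01 u; rewrite subr_ge0. Qed.

Lemma miss_le1 A : miss A <= 1.
Proof.
apply: prodr_ile1 => u _; have /andP[] := a01 u.
by rewrite subr_ge0 gerBl => -> ->.
Qed.

Lemma le_miss A (B : {set T}) : A \subset B -> miss B <= miss A.
Proof.
move=> sAB; rewrite /miss (big_setID A) /=.
have -> : B :&: A = A by apply/finset.setIidPr.
by rewrite ler_piMr ?miss_ge0 ?miss_le1.
Qed.

Lemma miss_le_expR A : miss A <= expR (- \sum_(u in A) a u).
Proof.
rewrite /miss -sumrN expR_sum; apply: ler_prod => u _.
have /andP[] := a01 u; rewrite subr_ge0 => _ -> /=.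
exact: expR_ge1Dx.
Qed.

(** The errors of the single factors add up, since all partial products lie in [[0, 1]]; hence the
    strengthened induction. *)
Lemma miss_ge_expR A :
  expR (- \sum_(u in A) a u) - \sum_(u in A) a u ^+ 2 <= miss A.
Proof.
suff [] : [/\ expR (- \sum_(u in A) a u) - \sum_(u in A) a u ^+ 2 <= miss A,
    0 <= expR (- \sum_(u in A) a u) <= 1 & 0 <= \sum_(u in A) a u ^+ 2] by [].
rewrite /miss -sumrN expR_sum.
elim/big_rec3 : _ => [|u x y z uA [h z01 x0]]; first by rewrite subr0 !lexx ler01.
have /andP[a0 a1] := a01 u; have := expR_gt0 (- a u).
have : expR (- a u) <= 1 by rewrite -[leRHS](@expR0 R) ler_expR oppr_le0.
(* From [expR (- a) <= 1 / (1 + a)] and [(1 + a) * (1 - a + a ^+ 2) = 1 + a ^+ 3]. *)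
have : expR (- a u) - a u ^+ 2 <= 1 - a u.
  rewrite expRN lerBlDr; apply: (@le_trans _ _ (1 + a u)^-1).
    by rewrite lef_pV2 ?posrE ?expR_gt0 ?expR_ge1Dx//; lra.
  rewrite -[leLHS]mul1r ler_pdivrMr; last by lra.
  have := exprn_ge0 3 a0; nra.
move: (expR (- a u)) => e; move: z01 => /andP[z0 z1] e1 e2 e3.
have s0 := sqr_ge0 (a u).
split; [|apply/andP; split; nra|exact: addr_ge0].
have p1 : 0 <= (1 - a u) * (y - (z - x)) by rewrite mulr_ge0 ?subr_ge0.
have p2 : 0 <= (1 - a u - e + a u ^+ 2) * z by rewrite mulr_ge0 //; lra.
have p3 : 0 <= a u * x by rewrite mulr_ge0.
have p4 : 0 <= a u ^+ 2 * (1 - z) by rewrite mulr_ge0 ?subr_ge0.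
lra.
Qed.

Lemma miss_setD1 A u : u \in A -> miss (A :\ u) <= miss A + a u.
Proof.
move=> uA; rewrite {2}/miss (bigD1 u)//=.
have -> : \prod_(i in A | i != u) (1 - a i) = miss (A :\ u).
  by apply: eq_bigl => w; rewrite finset.in_setD1 andbC.
have /andP[a0 a1] := a01 u; have := miss_le1 (A :\ u); have := miss_ge0 (A :\ u).
by nra.
Qed.

Lemma hitsE A N : hits A N = (0 < #|N :&: A|)%N.
Proof.
apply/hitsP/idP => [[u uN uA]|/card_gt0P[u]]; first by apply/card_gt0P; exists u; rewrite inE uN.
by rewrite inE => /andP[uN uA]; exists u.
Qed.

Lemma hits_onceE A N u : u \in A ->
  (u \in N) && ~~ hits (A :\ u) N = (N :&: A == [set u]).
Proof.
move=> uA; apply/andP/eqP => [[uN hN]|NA].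
  apply/setP => w; rewrite !inE; apply/andP/eqP => [[wN wA]|-> //].
  apply: contraNeq hN => wu; apply/hitsP; exists w => //.
  by rewrite finset.in_setD1 wu.
have uN : u \in N by have : u \in N :&: A; [rewrite NA finset.set11|rewrite inE => /andP[]].
split=> //; apply/hitsP => -[w wN]; rewrite finset.in_setD1 => /andP[wu wA].
have : w \in N :&: A by rewrite inE wN.
by rewrite NA finset.in_set1 (negbTE wu).
Qed.

Lemma sum_hits_once A N :
  \sum_(u in A) ((u \in N) && ~~ hits (A :\ u) N)%:R = (#|N :&: A| == 1)%N%:R :> R.
Proof.
rewrite (eq_bigr (fun u => (N :&: A == [set u])%:R)); last first.
  by move=> u uA; rewrite hits_onceE.
case: (boolP (_ == 1)%N) => [/cards1P[w NA]|hN].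
  have wA : w \in A by have : w \in N :&: A; [rewrite NA finset.set11|rewrite inE => /andP[]].
  rewrite (bigD1 w)//= NA eqxx big1 ?addr0// => u /andP[_ uw].
  by case: eqP => // /setP/(_ u); rewrite !inE eqxx (negbTE uw).
rewrite big1// => u uA; case: eqP => // NA.
by rewrite NA cards1 in hN.
Qed.

(** The cases of no element and of exactly one element in [A] are subtracted. The main term is the
    Poisson probability of at least two points; replacing [miss (A :\ u)] by [miss A] costs
    [a u ^+ 2] for each [u]. *)
Lemma mean_hits2 A :
  1 - expR (- \sum_(u in A) a u) * (1 + \sum_(u in A) a u) - \sum_(u in A) a u ^+ 2
  <= mean random_set (fun N => (1 < #|N :&: A|)%N%:R).
Proof.
have dR := random_set_distribution.
rewrite (@eq_mean _ _ _ _ (fun N => 1 + -1 * (~~ hits A N)%:R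
   + -1 * \sum_(u in A) ((u \in N) && ~~ hits (A :\ u) N)%:R)); last first.
  move=> N; rewrite hitsE (sum_hits_once A N).
  by case: #|_| => [|[|k]] /=; lra.
rewrite !meanD !meanZ mean_cst// mean_hitsN mean_sum.
rewrite [X in _ + -1 * X](eq_bigr (fun u => a u * miss (A :\ u))); last first.
  by move=> u uA; exact: mean_hits_once.
have : \sum_(u in A) a u * miss (A :\ u) <= \sum_(u in A) (a u * miss A + a u ^+ 2).
  apply: ler_sum => u uA; have := miss_setD1 uA; have /andP[a0 _] := a01 u.
  by nra.
rewrite big_split /= -mulr_suml.
have := miss_le_expR A; set z := \sum_(u in A) a u.
have : 0 <= z by apply: sumr_ge0 => u _; have /andP[] := a01 u.
by nra.
Qed.

Lemma prod_setD1_ge c u : (forall w, a w <= 1 / 2) -> \sum_w a w <= c ->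
  expR (- (2 * c)) <= miss (~: [set u]).
Proof.
move=> a12 ac; apply: (@le_trans _ _ (miss [set: T])); last exact/le_miss/finset.subsetT.
apply: (@le_trans _ _ (expR (\sum_w - (2 * a w)))).
  by rewrite ler_expR sumrN lerN2 -mulr_sumr ler_pM2l.
rewrite expR_sum /miss [leRHS](eq_bigl xpredT) => [|w]; last exact: finset.in_setT.
apply: ler_prod => w _; rewrite expR_ge0 /= expRN.
have /andP[a0 a1] := a01 w; have := expR_ge1Dx (2 * a w); have := a12 w => h1 h2.
(* On [[0, 1/2]] one has [(1 - a) * (1 + 2 * a) >= 1], hence [1 - a >= expR (- (2 * a))]. *)
rewrite -[leLHS]mul1r ler_pdivrMr ?expR_gt0//; nra.
Qed.

Lemma random_set1_ge c u : (forall w, a w <= 1 / 2) -> \sum_w a w <= c ->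
  expR (- (2 * c)) * a u <= random_set [set u].
Proof.
move=> a12 ac; rewrite /random_set (bigD1 u)//= finset.set11 mulrC.
have /andP[a0 a1] := a01 u; apply: ler_wpM2l => //.
apply: le_trans (prod_setD1_ge u a12 ac) _; rewrite /miss le_eqVlt; apply/orP; left.
apply/eqP; apply: eq_big => w; first by rewrite finset.in_setC finset.in_set1.
by rewrite finset.in_setC finset.in_set1 => /negbTE ->.
Qed.

End RandomSet.

(** * The lower bound on the matching number *)

Section Demands.
Local Open Scope ring_scope.
Variables (R : realType) (T Y : finType) (q : Y -> R) (x : Y -> T -> R).
Hypothesis dq : distribution q.
Hypothesis x01 : forall y u, 0 <= x y u <= 1.
Implicit Types (v : Y * {set T}) (w r : seq (Y * {set T})) (l : nat) (y : Y) (u : T).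

(* A demand node is represented by its type and its neighbourhood. *)
Definition demand_law v : R := q v.1 * random_set (x v.1) v.2.

Definition nbrs w : seq {set T} := [seq v.2 | v <- w].
Definition low w : {set T} := least_optimal (nbrs w).
Definition high w : {set T} := greatest_optimal (nbrs w).

Lemma mean_demand (g : Y * {set T} -> R) :
  mean demand_law g = \sum_y q y * mean (random_set (x y)) (fun N => g (y, N)).
Proof.
rewrite /mean; under [RHS]eq_bigr do rewrite mulr_sumr.
by rewrite pair_bigA; apply: eq_bigr => -[y N] _ /=; rewrite mulrA.
Qed.

Lemma demand_law_distribution : distribution demand_law.
Proof.
split=> [[y N]|].
  by rewrite mulr_ge0 ?dq.1// (random_set_distribution (x01 y)).1.
transitivity (mean demand_law (fun=> 1)); first by apply: eq_bigr => v _; rewrite mulr1.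
rewrite mean_demand -[RHS]dq.2; apply: eq_bigr => y _.
by rewrite mean_cst ?mulr1//; exact: (random_set_distribution (x01 y)).
Qed.

Let dD := demand_law_distribution.

Lemma mean_demand_type y (g : {set T} -> R) :
  mean demand_law (fun v => (v.1 == y)%:R * g v.2) = q y * mean (random_set (x y)) g.
Proof.
rewrite mean_demand (bigD1 y)//= eqxx big1 ?addr0 => [|z zy].
  by congr (_ * _); apply: eq_mean => N; rewrite mul1r.
rewrite (@eq_mean _ _ _ _ (fun=> 0)) ?mean_cst ?mulr0//.
- exact: (random_set_distribution (x01 z)).
- by move=> N; rewrite (negbTE zy) mul0r.
Qed.

Lemma perm_nbrs w1 w2 : perm_eq w1 w2 -> perm_eq (nbrs w1) (nbrs w2).
Proof. exact: perm_map. Qed.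

Lemma low_cons_sub v w : low (v :: w) \subset low w.
Proof. exact: least_optimal_cons_sub. Qed.

(** * Marginal gains and lost pairs *)

Definition mean_number l : R :=
  mean_seq demand_law l (fun w => (cover_number (nbrs w))%:R).

Definition gain l : R := mean_number l.+1 - mean_number l.

Lemma gainE l :
  gain l = mean_seq demand_law l (fun w => mean demand_law (fun v => (hits (low w) v.2)%:R)).
Proof.
rewrite /gain /mean_number mean_seqS -mean_seqB; apply: eq_mean_seq => w _.
rewrite -[X in _ - X](mean_cst _ dD) -meanB; apply: eq_mean => v.
by rewrite /= cover_number_cons natrD addrAC subrr add0r.
Qed.

Lemma gain_ge0 l : 0 <= gain l.
Proof.
by rewrite gainE; apply: mean_seq_ge0 => // w; apply: mean_ge0 => // v; rewrite ler0n.
Qed.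

Lemma gain_le1 l : gain l <= 1.
Proof.
rewrite gainE -[leRHS](mean_seq_cst l _ dD); apply: le_mean_seq => // w _.
by rewrite -[leRHS](mean_cst _ dD); apply: le_mean => // v; rewrite lern1 leq_b1.
Qed.

Lemma le_hits_low v w N : hits (low (v :: w)) N -> hits (low w) N.
Proof. exact/hitsS/low_cons_sub. Qed.

(** [low] shrinks as demand nodes arrive: the mean matching number is concave in their number. *)
Lemma gainS l : gain l.+1 <= gain l.
Proof.
rewrite !gainE; apply: ge_mean_seqS => // v w; apply: le_mean => // v'.
by rewrite ler_nat; case: hits (@le_hits_low v w v'.2) => //= ->.
Qed.

(** The conditional probability, given [w], that a new demand node of type [y] does not raise the
    matching number. *)
Definition missed y w : R := miss (x y) (low w).

Lemma missed_cons v w y : missed y w <= missed y (v :: w).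
Proof. exact/le_miss/low_cons_sub. Qed.

Lemma missed_ge0 y w : 0 <= missed y w.
Proof. exact: miss_ge0. Qed.

Lemma missed_le1 y w : missed y w <= 1.
Proof. exact: miss_le1. Qed.

Lemma mean_hits_low w :
  mean demand_law (fun v => (hits (low w) v.2)%:R) = 1 - \sum_y q y * missed y w.
Proof.
rewrite mean_demand -[X in X - _]dq.2 -sumrB; apply: eq_bigr => y _.
rewrite -{2}[q y]mulr1 -mulrBr; congr (_ * _).
have dR := random_set_distribution (x01 y).
rewrite /missed -mean_hitsN// -{2}(mean_cst 1 dR) -meanB; apply: eq_mean => N /=.
by case: hits => /=; lra.
Qed.

Lemma gain_missed l : gain l = 1 - \sum_y q y * mean_seq demand_law l (missed y).
Proof.
rewrite gainE (@eq_mean_seq _ _ _ _ _ (fun w => 1 - \sum_y q y * missed y w)).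
  rewrite mean_seqB mean_seq_cst// mean_seq_sum; congr (_ - _).
  by apply: eq_bigr => y _; rewrite mean_seqZ.
by move=> w _; exact: mean_hits_low.
Qed.

(** By [gain_missed] the drop of the gain is the sum of these terms over all types, and each is
    non-negative because [low] shrinks. *)
Lemma missed_drift y l : q y *
    (mean_seq demand_law l.+2 (missed y) - mean_seq demand_law l (missed y))
  <= gain l - gain l.+2.
Proof.
have le2 z : mean_seq demand_law l (missed z) <= mean_seq demand_law l.+2 (missed z).
  apply: (@le_trans _ _ (mean_seq demand_law l.+1 (missed z)));
    by apply: le_mean_seqS => // v w; exact: missed_cons.
rewrite !gain_missed (_ : forall a b : R, 1 - a - (1 - b) = b - a); last by move=> a b; ring.
rewrite -sumrB (bigD1 y)//= mulrBr lerDl.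
by apply: sumr_ge0 => z _; rewrite -mulrBr mulr_ge0 ?subr_ge0// dq.1.
Qed.

(* The mean of the indicator that [v] and [v'] are useful separately, but [v']
   is useless after [v]. *)
Lemma gain_diff l : gain l - gain l.+1 =
  mean_seq demand_law l (fun w => mean demand_law (fun v => mean demand_law (fun v' =>
    (hits (low w) v'.2)%:R - (hits (low (v :: w)) v'.2)%:R))).
Proof.
rewrite !gainE [X in _ - X]mean_seqS -mean_seqB; apply: eq_mean_seq => w _.
rewrite -[X in X - _](mean_cst _ dD) -meanB; apply: eq_mean => v.
by rewrite meanB.
Qed.

Lemma hits_low_diff_ge0 v v' w :
  0 <= (hits (low w) v'.2)%:R - (hits (low (v :: w)) v'.2)%:R :> R.
Proof.
by rewrite subr_ge0 ler_nat; case: hits (@le_hits_low v w v'.2) => //= ->.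
Qed.

(* Both [u] and [t] can be missed by a maximum matching, but not together. *)
Definition lost_pair r u t : bool :=
  [&& t \in low r, u \in low r & u \notin least_optimal ([set t]%SET :: nbrs r)].

Definition lost_weight y r : R :=
  \sum_u \sum_(t | t != u) x y u * x y t * (lost_pair r u t)%:R.

(** If the new node no longer hits [low] after its own insertion, any two of its neighbours in
    [low r] form a lost pair, by [least_optimal_cons_hits]. *)
Lemma two_hits_le r y N :
  (1 < #|N :&: low r|)%N%:R <= (hits (low ((y, N) :: r)) N)%:R +
    \sum_u \sum_(t | t != u) ((u \in N) && (t \in N))%:R * (lost_pair r u t)%:R :> R.
Proof.
have s0 : 0 <= \sum_u \sum_(t | t != u)
    ((u \in N) && (t \in N))%:R * (lost_pair r u t)%:R :> R.
  by apply: sumr_ge0 => u _; apply: sumr_ge0 => t _; rewrite mulr_ge0.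
case: (boolP (1 < _)%N) => [/card_gt1P[u [t [uN tN uw]]]|_]; last first.
  by rewrite addr_ge0.
case: (boolP (hits _ N)) => [_|hN]; first by rewrite lerDl.
move: uN tN; rewrite !inE => /andP[uN uA] /andP[tN tA].
rewrite add0r (bigD1 u)//= (bigD1 t) 1?eq_sym//= uN tN mul1r.
have -> : lost_pair r u t.
  apply/and3P; split=> //; apply: contra hN => uB.
  exact: least_optimal_cons_hits uN tN tA uB.
rewrite -addrA lerDl addr_ge0//; apply: sumr_ge0 => i _; first by rewrite mulr_ge0.
by apply: sumr_ge0 => t0 _; rewrite mulr_ge0.
Qed.

Lemma mean_two_hits r :
  mean demand_law (fun v => (1 < #|v.2 :&: low r|)%N%:R) <=
  mean demand_law (fun v => (hits (low (v :: r)) v.2)%:R) +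
    \sum_y q y * lost_weight y r.
Proof.
rewrite !mean_demand -big_split; apply: ler_sum => y _ /=.
rewrite -mulrDr; apply: ler_wpM2l; first exact: dq.1.
have dR := random_set_distribution (x01 y).
apply: (le_trans (le_mean dR (two_hits_le r y))); rewrite meanD lerD2l.
rewrite mean_sum; apply: ler_sum => u _; rewrite mean_sum; apply: ler_sum => t wu.
under eq_mean do rewrite mulrC.
by rewrite meanZ mean_mem2 1?eq_sym// mulrC.
Qed.

Lemma mean_demand_ge y (g : Y * {set T} -> R) : (forall v, 0 <= g v) ->
  q y * mean (random_set (x y)) (fun N => g (y, N)) <= mean demand_law g.
Proof.
move=> g0; rewrite mean_demand (bigD1 y)//= lerDl; apply: sumr_ge0 => z _.
by rewrite mulr_ge0 ?dq.1// mean_ge0//; exact: (random_set_distribution (x01 z)).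
Qed.

Lemma mean_random_set_ge y (g : {set T} -> R) : (forall N, 0 <= g N) ->
  \sum_u random_set (x y) [set u]%SET * g [set u]%SET <= mean (random_set (x y)) g.
Proof.
move=> g0; have [P0 _] := random_set_distribution (x01 y).
have -> : \sum_u random_set (x y) [set u]%SET * g [set u]%SET =
    \sum_(N in [set [set u] | u : T]%SET) random_set (x y) N * g N.
  by rewrite big_imset //= => u t _ _ /finset.set1_inj.
rewrite /mean [leRHS](bigID (mem [set [set u] | u : T]%SET)) /= lerDl.
by apply: sumr_ge0 => N _; rewrite mulr_ge0.
Qed.

Variable c : R.
Hypothesis x12 : forall y u, x y u <= 1 / 2.
Hypothesis sum_x : forall y, \sum_u x y u <= c.

(** Only demand nodes of type [y] with a single neighbour are kept, [t] for [v] and [u] for [v'].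
    For these the difference on the right is at least the indicator of a lost pair. *)
Lemma lost_weight_le y r : (q y * expR (- (2 * c))) ^+ 2 * lost_weight y r <=
  mean demand_law (fun v => mean demand_law (fun v' =>
    (hits (low r) v'.2)%:R - (hits (low (v :: r)) v'.2)%:R)).
Proof.
have d0 := hits_low_diff_ge0.
have k0 u : 0 <= expR (- (2 * c)) * x y u.
  by rewrite mulr_ge0 ?expR_ge0//; have /andP[] := x01 y u.
have kx u : expR (- (2 * c)) * x y u <= random_set (x y) [set u]%SET.
  exact: random_set1_ge.
have R0 N : 0 <= random_set (x y) N by have [] := random_set_distribution (x01 y).
have q0 : 0 <= q y by exact: dq.1.
(* The restriction to single neighbours, used once for [v] and once for [v']; the exponential factor
   comes from [random_set1_ge]. *)
have step (g : Y * {set T} -> R) : (forall v, 0 <= g v) ->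
    q y * \sum_u expR (- (2 * c)) * x y u * g (y, [set u]%SET) <= mean demand_law g.
  move=> g0; apply: le_trans (mean_demand_ge y g0); apply: ler_wpM2l => //.
  apply: le_trans (mean_random_set_ge y _) => [|N]; last exact: g0.
  by apply: ler_sum => u _; exact: ler_wpM2r.
apply: le_trans (step _ _) => [|v]; last by apply: mean_ge0.
apply: (@le_trans _ _ (q y * \sum_t expR (- (2 * c)) * x y t * (q y *
   \sum_u expR (- (2 * c)) * x y u * (lost_pair r u t && (t != u))%:R))); last first.
  apply: ler_wpM2l => //; apply: ler_sum => t _; apply: ler_wpM2l => //.
  apply: le_trans (step _ _) => [|v]; last exact: d0.
  apply: ler_wpM2l => //; apply: ler_sum => u _; apply: ler_wpM2l => //=.
  have := d0 (y, [set t]%SET) (y, [set u]%SET) r; rewrite /= !hits_set1.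
  rewrite /lost_pair /low /=; case: (t \in _) => //=; case: (u \in _) => //=.
  by case: (u \in _) => //=; case: (t == u) => //=; lra.
rewrite le_eqVlt; apply/orP; left; apply/eqP.
rewrite /lost_weight (exchange_big_dep xpredT) //= !mulr_sumr; apply: eq_bigr => t _.
rewrite !mulr_sumr big_mkcond /=; apply: eq_bigr => u _.
by rewrite andbC; case: (t != u) => /=; ring.
Qed.

(* Single-node neighbourhoods have positive probability, so the second difference
   of the mean matching number controls lost pairs. Types with [q y = 0] do not
   contribute, as [0^-1 = 0]. *)
Lemma mean_lost_weight l : mean_seq demand_law l (fun r => \sum_y q y * lost_weight y r)
  <= (\sum_y (q y)^-1 * expR (4 * c)) * (gain l - gain l.+1).
Proof.
rewrite mean_seq_sum mulr_suml; apply: ler_sum => y _; rewrite mean_seqZ.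
have h : (q y * expR (- (2 * c))) ^+ 2 * mean_seq demand_law l (lost_weight y) <=
    gain l - gain l.+1.
  by rewrite -mean_seqZ gain_diff; apply: le_mean_seq => // r _; exact: lost_weight_le.
have [q0|q0] := eqVneq (q y) 0; first by rewrite q0 invr0 !mul0r.
have qp : 0 < q y by rewrite lt_neqAle eq_sym q0; exact: dq.1.
have -> : q y * mean_seq demand_law l (lost_weight y) = (q y)^-1 * expR (4 * c) *
   ((q y * expR (- (2 * c))) ^+ 2 * mean_seq demand_law l (lost_weight y)).
  have -> : 4 * c = 2 * c + 2 * c by ring.
  rewrite expRD expRN; have := expR_gt0 (2 * c); move: (expR _) => e e0.
  by field; rewrite q0 (gt_eqF e0).
by rewrite ler_wpM2l// mulr_ge0 ?expR_ge0// invr_ge0 ltW.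
Qed.

(** * Missed demand nodes and their concentration *)

Definition unhit y w : nat := count [pred v | (v.1 == y) && ~~ hits (high w) v.2] w.

Definition drop_node u v : Y * {set T} := (v.1, v.2 :\ u)%SET.

Lemma nbrs_drop_node u w : nbrs (map (drop_node u) w) = isolate u (nbrs w).
Proof. by rewrite /nbrs /isolate -!map_comp. Qed.

(** Given the neighbours other than [u], the edge to [u] is absent with probability [1 - x v.1 u].
    This is the hypothesis of [mean_seq_resample_fin] for [drop_node u]. *)
Lemma mean_drop_node u (X : {set T}) (g : Y * {set T} -> R) :
  mean demand_law (fun v => g (drop_node u v) *
    (if hits X (v.2 :\ u)%SET then 1 else (u \notin v.2)%:R)) =
  mean demand_law (fun v => g (drop_node u v) *
    (if hits X (v.2 :\ u)%SET then 1 else 1 - x v.1 u)).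
Proof.
rewrite !mean_demand; apply: eq_bigr => y _; congr (_ * _) => /=.
have e (d : {set T} -> R) : mean (random_set (x y)) (fun N => g (drop_node u (y, N)) *
      (if hits X (N :\ u)%SET then 1 else d N)) =
    mean (random_set (x y)) (fun N => g (y, N :\ u)%SET * (hits X (N :\ u)%SET)%:R) +
    mean (random_set (x y)) (fun N => g (y, N :\ u)%SET * (~~ hits X (N :\ u)%SET)%:R * d N).
  rewrite -meanD; apply: eq_mean => N; rewrite /drop_node /=.
  by case: hits => /=; ring.
rewrite !e; congr (_ + _).
exact: (mean_setD1 (x y) u (fun N => g (y, N) * (~~ hits X N)%:R)).
Qed.

(* A supply node missed by some maximum matching has no neighbour that is missed
   in the graph where it is isolated, and the latter graph is independent of the
   edges of the node. *)
Lemma mem_low_le u w : (u \in low w)%:R <=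
  \prod_(v <- w) (if hits (high (map (drop_node u) w)) (v.2 :\ u)%SET
                  then 1 else (u \notin v.2)%:R) :> R.
Proof.
case: (boolP (u \in low w)) => ulow; last first.
  by apply: prodr_ge0 => v _; case: ifP.
rewrite big_seq big1// => v vw; rewrite /high nbrs_drop_node.
case: ifPn => // h; case: (boolP (u \in v.2)) => // uv.
by rewrite (hits_greatest_isolate ulow _ uv)// in h; exact: map_f.
Qed.

Lemma sum_by_type (f : Y -> R) (p : pred (Y * {set T})) w :
  \sum_(v <- w) (if p v then 0 else f v.1) =
  \sum_y f y * (count [pred v | (v.1 == y) && ~~ p v] w)%:R.
Proof.
elim: w => [|v w IH]; first by rewrite big_nil big1// => y _; rewrite mulr0.
rewrite big_cons IH /=.
have -> : (if p v then 0 else f v.1) = \sum_y f y * ((v.1 == y) && ~~ p v)%:R.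
  rewrite (bigD1 v.1)//= eqxx big1 ?addr0 => [|y /negbTE].
    by case: (p v); rewrite ?mulr0 ?mulr1.
  by rewrite eq_sym => ->; rewrite mulr0.
by rewrite -big_split; apply: eq_bigr => y _; rewrite natrD mulrDr.
Qed.

(** By [greatest_isolate_sub], a demand node that does not hit [high w] does not hit its analogue
    with [u] isolated either, so it contributes a factor [1 - x v.1 u <= expR (- x v.1 u)]. *)
Lemma prod_unhit_le u w :
  \prod_(v <- w) (if hits (high (map (drop_node u) w)) (v.2 :\ u)%SET
                  then 1 else 1 - x v.1 u) <=
  expR (- \sum_y x y u * (unhit y w)%:R).
Proof.
apply: (@le_trans _ _ (\prod_(v <- w) (if hits (high w) v.2 then 1 else 1 - x v.1 u))).
  apply: ler_prod => v _; have /andP[x0 x1] := x01 v.1 u.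
  rewrite /high nbrs_drop_node; case: ifPn => h.
    by rewrite ler01 /= (greatest_isolate_sub h).
  by rewrite subr_ge0 x1; case: ifP => _; rewrite ?lexx// gerBl.
apply: (@le_trans _ _ (\prod_(v <- w) expR (if hits (high w) v.2 then 0 else - x v.1 u))).
  apply: ler_prod => v _; have /andP[x0 x1] := x01 v.1 u.
  case: ifP => _; first by rewrite expR0 ler01 lexx.
  by rewrite subr_ge0 x1 expR_ge1Dx.
rewrite -expR_sum ler_expR le_eqVlt; apply/orP; left; apply/eqP.
rewrite (sum_by_type (fun y => - x y u)) -sumrN; apply: eq_bigr => y _.
by rewrite mulNr.
Qed.

(** After [mem_low_le], the absence of an edge at [u] is replaced by its conditional probability,
    since [high] of the isolated graph does not depend on the edges of [u]. *)
Lemma mean_card_low l : mean_seq demand_law l (fun w => #|low w|%:R) <=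
  \sum_u mean_seq demand_law l (fun w => expR (- \sum_y x y u * (unhit y w)%:R)).
Proof.
rewrite (@eq_mean_seq _ _ _ _ _ (fun w => \sum_u (u \in low w)%:R)); last first.
  by move=> w _; rewrite -sum1_card natr_sum big_mkcond; apply: eq_bigr => u _; case: ifP.
rewrite mean_seq_sum; apply: ler_sum => u _.
apply: (le_trans (le_mean_seq dD (fun w _ => mem_low_le u w))).
rewrite (mean_seq_resample_fin (fun w => high w) l (mean_drop_node u)).
by apply: le_mean_seq => // w _; exact: prod_unhit_le.
Qed.

Definition unhit_at y v w : R := ((v.1 == y) && ~~ hits (high w) v.2)%:R.

Lemma unhitE y w : (unhit y w)%:R = \sum_(v <- w) unhit_at y v w.
Proof.
rewrite /unhit_at /unhit; move: (high w) => A.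
elim: w => [|v w IH]; first by rewrite big_nil.
by rewrite big_cons /= natrD IH.
Qed.

Lemma perm_high w1 w2 : perm_eq w1 w2 -> high w1 = high w2.
Proof. by move=> /perm_nbrs/perm_greatest_optimal. Qed.

Lemma perm_low w1 w2 : perm_eq w1 w2 -> low w1 = low w2.
Proof. by move=> /perm_nbrs/perm_least_optimal. Qed.

Lemma perm_unhit y w1 w2 : perm_eq w1 w2 -> unhit y w1 = unhit y w2.
Proof. by move=> w12; rewrite /unhit (perm_high w12); apply/permP. Qed.

Lemma perm_unhit_at y v w1 w2 : perm_eq w1 w2 -> unhit_at y v w1 = unhit_at y v w2.
Proof. by move=> w12; rewrite /unhit_at (perm_high w12). Qed.

Lemma unhit_at_cons y v w : unhit_at y v (v :: w) = ((v.1 == y) && ~~ hits (low w) v.2)%:R.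
Proof. by rewrite /unhit_at /high /= hits_greatest_optimal. Qed.

Lemma unhit_at_ge0 y v w : 0 <= unhit_at y v w.
Proof. exact: ler0n. Qed.

Lemma unhit_at_le1 y v w : unhit_at y v w <= 1.
Proof. by rewrite lern1 leq_b1. Qed.

Lemma mean_missed y w (b : R) :
  mean demand_law (fun v => ((v.1 == y) && ~~ hits (low w) v.2)%:R * b) =
  q y * missed y w * b.
Proof.
rewrite (@eq_mean _ _ _ _ (fun v => b * ((v.1 == y)%:R * (~~ hits (low w) v.2)%:R))).
  rewrite meanZ (mean_demand_type y (fun N => (~~ hits (low w) N)%:R)) mean_hitsN.
  by rewrite mulrC.
by move=> v; rewrite mulrC -natrM mulnb.
Qed.

(** If [v'] does not hit [low w], its insertion leaves [low] unchanged and each indicator is as if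
    the other node were absent. If it does hit [low w], it can be unhit only because of [v], and
    then the second term is 1. *)
Lemma unhit_at_pair y v v' w :
  unhit_at y v (v :: v' :: w) * unhit_at y v' (v :: v' :: w) <=
  ((v.1 == y) && ~~ hits (low w) v.2)%:R * ((v'.1 == y) && ~~ hits (low w) v'.2)%:R +
  ((hits (low w) v'.2)%:R - (hits (low (v :: w)) v'.2)%:R).
Proof.
have -> : unhit_at y v' (v :: v' :: w) = unhit_at y v' (v' :: v :: w).
  apply: perm_unhit_at; rewrite -[v :: v' :: w]/([:: v; v'] ++ w).
  by rewrite -[v' :: v :: w]/([:: v'; v] ++ w) perm_cat2r (perm_catC [:: v] [:: v']).
rewrite !unhit_at_cons; have := hits_low_diff_ge0 v v' w.
case: (boolP (hits (low w) v'.2)) => [h|h].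
  case: (hits (low (v :: w)) v'.2) => /=; rewrite ?andbF ?mulr0 ?subr0 ?add0r => _.
    by lra.
  by rewrite -natrM mulnb lern1 leq_b1.
have -> : low (v' :: w) = low w by exact: least_optimal_cons_disjoint.
case: (boolP (hits (low (v :: w)) v'.2)) => [/le_hits_low|_ _]; first by rewrite (negbTE h).
by rewrite subr0 addr0.
Qed.

(** The diagonal contributes at most [l.+2]. For two distinct nodes, [unhit_at_pair] leaves two
    indicators that are independent given [w], and an error of mean [gain l - gain l.+1]. *)
Lemma mean_unhit_sqr y l : mean_seq demand_law l.+2 (fun w => (unhit y w)%:R ^+ 2) <=
  l.+2%:R + l.+2%:R ^+ 2 * (q y ^+ 2 * mean_seq demand_law l (fun w => missed y w ^+ 2)
    + (gain l - gain l.+1)).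
Proof.
rewrite (@eq_mean_seq _ _ _ _ _ (fun w => \sum_(v <- w) unhit_at y v w * (unhit y w)%:R));
  last by move=> w _; rewrite -mulr_suml -unhitE expr2.
rewrite mean_seq_sum_mem; last first.
  by move=> v w1 w2 w12; rewrite (perm_unhit_at y v w12) (perm_unhit y w12).
have l0 : 0 <= l.+2%:R :> R by exact: ler0n.
suff : mean demand_law (fun v => mean_seq demand_law l.+1 (fun r =>
    unhit_at y v (v :: r) * (unhit y (v :: r))%:R)) <=
    1 + l.+2%:R * (q y ^+ 2 * mean_seq demand_law l (fun w => missed y w ^+ 2)
    + (gain l - gain l.+1)).
  by move=> h; apply: (le_trans (ler_wpM2l l0 h)); rewrite expr2; lra.
apply: (@le_trans _ _ (mean demand_law (fun v => mean_seq demand_law l.+1 (fun r =>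
    1 + \sum_(v' <- r) unhit_at y v (v :: r) * unhit_at y v' (v :: r))))).
  apply: le_mean => // v; apply: le_mean_seq => // r _.
  rewrite unhitE big_cons mulrDr -mulr_sumr lerD2r.
  by rewrite mulr_ile1 ?unhit_at_ge0 ?unhit_at_le1.
under eq_mean do rewrite mean_seqD mean_seq_cst//.
rewrite meanD mean_cst// lerD2l.
under eq_mean => v.
  rewrite (mean_seq_sum_mem _ _ (g := fun v' r =>
     unhit_at y v (v :: r) * unhit_at y v' (v :: r))); last first.
    move=> v' w1 w2 w12; have w12' : perm_eq (v :: w1) (v :: w2) by rewrite perm_cons.
    by rewrite !(perm_unhit_at _ _ w12').
  over.
rewrite meanZ.
have h : mean demand_law (fun v => mean demand_law (fun v' => mean_seq demand_law l (fun r =>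
    unhit_at y v (v :: v' :: r) * unhit_at y v' (v :: v' :: r)))) <=
  q y ^+ 2 * mean_seq demand_law l (fun w => missed y w ^+ 2) + (gain l - gain l.+1).
  rewrite gain_diff -mean_seqZ -mean_seqD.
  under eq_mean do rewrite -mean_seq_mean.
  rewrite -mean_seq_mean; apply: le_mean_seq => // w _.
  apply: (@le_trans _ _ (mean demand_law (fun v => mean demand_law (fun v' => 
     ((v'.1 == y) && ~~ hits (low w) v'.2)%:R * ((v.1 == y) && ~~ hits (low w) v.2)%:R +
     ((hits (low w) v'.2)%:R - (hits (low (v :: w)) v'.2)%:R))))).
    apply: le_mean => // v; apply: le_mean => // v'.
    by apply: le_trans (unhit_at_pair _ _ _ _) _; rewrite mulrC.
  under eq_mean do rewrite meanD mean_missed mulrC.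
  by rewrite meanD mean_missed lerD2r expr2; lra.
have h0 : 0 <= mean demand_law (fun v => mean demand_law (fun v' => mean_seq demand_law l (fun r =>
    unhit_at y v (v :: v' :: r) * unhit_at y v' (v :: v' :: r)))).
  apply: mean_ge0 => // v; apply: mean_ge0 => // v'; apply: mean_seq_ge0 => // r.
  by rewrite mulr_ge0 ?unhit_at_ge0.
apply: le_trans (ler_wpM2l l0 h); apply: ler_wpM2r => //.
by rewrite ler_nat.
Qed.

(** An unhit [v] leaves [low], hence [missed], unchanged; so its contribution has conditional mean
    [q y * missed y w ^+ 2] given the other nodes [w]. *)
Lemma mean_unhit_missed y l :
  l.+2%:R * (q y * mean_seq demand_law l (fun w => missed y w ^+ 2)) <=
  mean_seq demand_law l.+2 (fun w => (unhit y w)%:R * missed y w).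
Proof.
rewrite (@eq_mean_seq _ _ _ _ (fun w => _ * missed y w)
  (fun w => \sum_(v <- w) unhit_at y v w * missed y w)); last first.
  by move=> w _; rewrite -mulr_suml -unhitE.
rewrite mean_seq_sum_mem; last first.
  by move=> v w1 w2 w12; rewrite (perm_unhit_at y v w12) /missed (perm_low w12).
apply: ler_wpM2l; first exact: ler0n.
rewrite -mean_seq_mean.
rewrite (@eq_mean_seq _ _ _ l.+1 _ (fun w => q y * missed y w ^+ 2)); last first.
  move=> w _; rewrite expr2 mulrA -mean_missed; apply: eq_mean => v.
  rewrite unhit_at_cons; case: (boolP (hits (low w) v.2)) => [_|h].
    by rewrite andbF !mul0r.
  by rewrite /missed /low /= least_optimal_cons_disjoint.
rewrite mean_seqZ; apply: ler_wpM2l; first exact: dq.1.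
apply: le_mean_seqS => // v w; rewrite lerXn2r ?nnegrE ?missed_ge0//.
exact: missed_cons.
Qed.

Lemma missed_sqr_drift y l :
  mean_seq demand_law l.+2 (fun w => missed y w ^+ 2) -
    mean_seq demand_law l (fun w => missed y w ^+ 2) <=
  2 * (mean_seq demand_law l.+2 (missed y) - mean_seq demand_law l (missed y)).
Proof.
(* The function [2 * a - a ^+ 2] is non-decreasing on [[0, 1]], and [missed] grows with the
   sample. *)
have mono k : mean_seq demand_law k (fun w => 2 * missed y w - missed y w ^+ 2) <=
    mean_seq demand_law k.+1 (fun w => 2 * missed y w - missed y w ^+ 2).
  apply: le_mean_seqS => // v w; have := missed_cons v w y.
  have := missed_le1 y (v :: w); have := missed_ge0 y w.
  by move: (missed y w) (missed y _) => a b; nra.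
have := le_trans (mono l) (mono l.+1); rewrite !mean_seqB !mean_seqZ; lra.
Qed.

(** In the expanded square the leading terms, [(L * q y) ^+ 2] times the mean of [missed y w ^+ 2]
    at [l], cancel. Of the factor 3, one unit bounds the pair errors and two the drift of
    [missed y w ^+ 2] from [l] to [l.+2]. *)
Lemma unhit_concentration y l :
  mean_seq demand_law l.+2 (fun w => ((unhit y w)%:R - l.+2%:R * (q y * missed y w)) ^+ 2)
  <= l.+2%:R + 3 * l.+2%:R ^+ 2 * (gain l - gain l.+2).
Proof.
set L := l.+2%:R; have L0 : 0 <= L by exact: ler0n.
rewrite (@eq_mean_seq _ _ _ _ _ (fun w => (unhit y w)%:R ^+ 2 +
    - (2 * L * q y) * ((unhit y w)%:R * missed y w) + (L * q y) ^+ 2 * missed y w ^+ 2)).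
  rewrite !mean_seqD !mean_seqZ.
  have := mean_unhit_sqr y l; have := mean_unhit_missed y l.
  have := missed_sqr_drift y l; have := missed_drift y l; have := gainS l.+1.
  have q0 : 0 <= q y by exact: dq.1.
  have q1 : q y <= 1 by rewrite -dq.2 (bigD1 y)//= lerDl sumr_ge0// => z _; exact: dq.1.
  rewrite -/L; set a := mean_seq _ l (fun w => missed y w ^+ 2).
  set b := mean_seq _ _ (fun w => (unhit y w)%:R * missed y w); set d := mean_seq _ l.+2 (fun w => missed y w ^+ 2).
  set E := mean_seq _ l.+2 (missed y) - _; set B2 := mean_seq _ _ (fun w => (unhit y w)%:R ^+ 2).
  move=> h1 h2 h3 h4 h5.
  have Lq0 : 0 <= 2 * L * q y by rewrite !mulr_ge0.
  have k1 := ler_wpM2l Lq0 h4.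
  have Lq2 : 0 <= (L * q y) ^+ 2 by exact: sqr_ge0.
  have k2 := ler_wpM2l Lq2 h3.
  have k3 : (L * q y) ^+ 2 * (2 * E) <= 2 * L ^+ 2 * (gain l - gain l.+2).
    have -> : (L * q y) ^+ 2 * (2 * E) = 2 * L ^+ 2 * (q y * (q y * E)) by ring.
    apply: ler_wpM2l; first by rewrite mulr_ge0 ?sqr_ge0.
    have g0 : 0 <= gain l - gain l.+2 by rewrite subr_ge0 (le_trans (gainS _) (gainS _)).
    by apply: (le_trans (ler_wpM2l q0 h2)); rewrite ler_piMl.
  have k4 : L ^+ 2 * (gain l - gain l.+1) <= L ^+ 2 * (gain l - gain l.+2).
    by rewrite ler_wpM2l ?sqr_ge0// lerD2l lerN2.
  by lra.
by move=> w _; ring.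
Qed.

(** * The deficiency in terms of the mean numbers of missed neighbours *)

Hypothesis x_le : forall y u, x y u <= c / #|T|%:R.
Hypothesis T0 : (0 < #|T|)%N.

Let N : R := #|T|%:R.

Let N0 : 0 < N. Proof. by rewrite ltr0n. Qed.

(** The mean number of neighbours in [low w] of a new demand node of type [y]. *)
Definition mass y w : R := \sum_(u in low w) x y u.

(** The probability that a Poisson variable of mean [z] is at least 2. *)
Definition two_prob (z : R) : R := 1 - expR (- z) * (1 + z).

Lemma two_prob_homo a b : 0 <= a -> a <= b -> two_prob a <= two_prob b.
Proof.
move=> a0 ab; rewrite /two_prob lerD2l lerN2.
have -> : expR (- a) = expR (- b) * expR (b - a) by rewrite -expRD; congr expR; ring.
rewrite -mulrA ler_wpM2l ?expR_ge0//.
have := expR_ge1Dx (b - a); nra.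
Qed.

Lemma two_prob_ge0 a : 0 <= a -> 0 <= two_prob a.
Proof.
by move=> a0; apply: le_trans (two_prob_homo (lexx 0) a0);
  rewrite /two_prob oppr0 expR0; lra.
Qed.

Lemma two_prob_le1 a : 0 <= a -> two_prob a <= 1.
Proof. by move=> a0; rewrite gerBl mulr_ge0 ?expR_ge0// addr_ge0. Qed.

Lemma mass_ge0 y w : 0 <= mass y w.
Proof. by apply: sumr_ge0 => u _; have /andP[] := x01 y u. Qed.

Lemma sum_subset_le y (A : {set T}) : \sum_(u in A) x y u <= \sum_u x y u.
Proof.
rewrite [leRHS](bigID (mem A)) /= lerDl.
by apply: sumr_ge0 => u _; have /andP[] := x01 y u.
Qed.

Lemma mass_le y w : mass y w <= \sum_u x y u.
Proof. exact: sum_subset_le. Qed.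

Lemma mass_cons v w y : mass y (v :: w) <= mass y w.
Proof.
rewrite /mass [leRHS](big_setID (low (v :: w))) /=.
have -> : low w :&: low (v :: w) = low (v :: w).
  by apply/finset.setIidPr; exact: low_cons_sub.
by rewrite lerDl; apply: sumr_ge0 => u _; have /andP[] := x01 y u.
Qed.

Lemma sum_sqr_x y (A : {set T}) : \sum_(u in A) x y u ^+ 2 <= c ^+ 2 / N.
Proof.
have c0 : 0 <= c by apply: le_trans (sum_x y); apply: sumr_ge0 => u _; have /andP[] := x01 y u.
apply: (@le_trans _ _ (\sum_(u in A) c / N * x y u)).
  apply: ler_sum => u _; rewrite expr2; have /andP[x0 _] := x01 y u.
  by rewrite ler_wpM2r// x_le.
rewrite -mulr_sumr.
have -> : c ^+ 2 / N = c / N * c by rewrite expr2 -mulrA mulrC; ring.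
apply: ler_wpM2l; first by rewrite divr_ge0// ltW.
exact: le_trans (sum_subset_le y A) (sum_x y).
Qed.

Let eps l : R := gain l - gain l.+2.

Let eps_ge0 l : 0 <= eps l.
Proof. by rewrite subr_ge0 (le_trans (gainS _) (gainS _)). Qed.

Let C1 : R := \sum_y (q y)^-1 * expR (4 * c).

Let C1_ge0 : 0 <= C1.
Proof. by apply: sumr_ge0 => y _; rewrite mulr_ge0 ?expR_ge0// invr_ge0 dq.1. Qed.

Let q0 y : 0 <= q y. Proof. exact: dq.1. Qed.

Let sum_qM (a : R) : \sum_y q y * a = a.
Proof. by rewrite -mulr_suml dq.2 mul1r. Qed.

(** Up to lost pairs, a demand node with two neighbours in [low] of the other nodes still hits [low]
    after its own insertion. The number of such neighbours is Poisson up to [c ^+ 2 / N], and the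
    last insertion can only lower [mass]. *)
Lemma mean_count_hits l :
  l.+2%:R * (mean_seq demand_law l.+2 (fun w => \sum_y q y * two_prob (mass y w))
    - c ^+ 2 / N - C1 * eps l) <=
  mean_seq demand_law l.+2 (fun w => (count (hits (low w)) (nbrs w))%:R).
Proof.
rewrite (@eq_mean_seq _ _ _ _ (fun w => (count _ _)%:R)
   (fun w => \sum_(v <- w) (hits (low w) v.2)%:R)); last first.
  move=> w _; rewrite /nbrs count_map; move: (low w) => A.
  by elim: w => [|v w IH]; rewrite ?big_nil// big_cons /= natrD IH.
rewrite mean_seq_sum_mem; last by move=> v w1 w2 w12; rewrite (perm_low w12).
rewrite -mean_seq_mean; apply: ler_wpM2l; first exact: ler0n.
apply: (@le_trans _ _ (mean_seq demand_law l.+1 (fun r =>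
   (\sum_y q y * two_prob (mass y r) - c ^+ 2 / N) - \sum_y q y * lost_weight y r))).
  rewrite mean_seqB mean_seqB mean_seq_cst//; apply: lerB.
    rewrite lerD2r; apply: ge_mean_seqS => // v w; apply: ler_sum => y _.
    by rewrite ler_wpM2l// two_prob_homo ?mass_ge0 ?mass_cons.
  apply: (le_trans (mean_lost_weight l.+1)); rewrite ler_wpM2l//.
  by rewrite lerD2r gainS.
apply: le_mean_seq => // r _; rewrite lerBlDr.
apply: le_trans (mean_two_hits r); rewrite mean_demand.
rewrite -[X in _ - X]sum_qM -sumrB; apply: ler_sum => y _ /=.
rewrite -mulrBr ler_wpM2l//; apply: le_trans (mean_hits2 (x01 y) (low r)).
by rewrite lerD2l lerN2; exact: sum_sqr_x.
Qed.

Lemma expRN_lipschitz (a b : R) : 0 <= a -> 0 <= b ->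
  expR (- a) <= expR (- b) + `|a - b|.
Proof.
move=> a0 b0; have [ab|ba] := leP b a.
  apply: (@le_trans _ _ (expR (- b))); last by rewrite lerDl.
  by rewrite ler_expR lerN2.
rewrite ltr0_norm ?subr_lt0// opprB.
have -> : expR (- b) = expR (- a) * expR (a - b) by rewrite -expRD; congr expR; ring.
have h1 := expR_ge1Dx (a - b).
have h2 : expR (- a) <= 1 by rewrite -[leRHS](@expR0 R) ler_expR oppr_le0.
by have := expR_ge0 (- a); nra.
Qed.

(** The Poisson probability that [u] has no missed neighbour when [N * q y * expR (- z y)] demand
    nodes of each type [y] are missed. *)
Definition unhit_limit (z : Y -> R) u : R :=
  expR (- \sum_y N * x y u * q y * expR (- z y)).

(** The exponents are compared in three steps, which give the terms of the inner sum: the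
    fluctuation of [unhit], the change from [size w] to [N], and the Poisson error in [missed]. *)
Lemma expR_unhit_le w (eta : R) u : (size w <= #|T|)%N -> 0 < eta ->
  expR (- \sum_y x y u * (unhit y w)%:R) <= unhit_limit (mass^~ w) u +
   c / N * \sum_y (N * eta + (N * eta)^-1 *
      ((unhit y w)%:R - (size w)%:R * (q y * missed y w)) ^+ 2
      + (N - (size w)%:R) + c ^+ 2).
Proof.
move=> sw eta0; set L := (size w)%:R : R.
have LN : L <= N by rewrite ler_nat.
have L0 : 0 <= L by exact: ler0n.
apply: le_trans (expRN_lipschitz _ (b := \sum_y N * x y u * q y * expR (- mass y w)) _) _.
- by apply: sumr_ge0 => y _; rewrite mulr_ge0//; have /andP[] := x01 y u.
- apply: sumr_ge0 => y _; have /andP[x0 _] := x01 y u.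
  by rewrite !mulr_ge0 ?expR_ge0// ltW.
rewrite lerD2l -sumrB; apply: (le_trans (ler_norm_sum _ _ _)).
rewrite mulr_sumr; apply: ler_sum => y _.
have /andP[x0 _] := x01 y u.
have -> : x y u * (unhit y w)%:R - N * x y u * q y * expR (- mass y w) =
  x y u * ((unhit y w)%:R - N * q y * expR (- mass y w)) by ring.
rewrite normrM ger0_norm//; apply: ler_pM => //.
have q1 : q y <= 1 by rewrite -dq.2 (bigD1 y)//= lerDl sumr_ge0.
have e0 := missed_ge0 y w; have e1 := missed_le1 y w.
have h1 : missed y w <= expR (- mass y w) by exact: miss_le_expR.
have h2 : expR (- mass y w) - c ^+ 2 / N <= missed y w.
  by apply: le_trans (miss_ge_expR (x01 y) (low w)); rewrite lerD2l lerN2 sum_sqr_x.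
set X := _ - L * _; set B := (unhit y w)%:R in X *.
(* An absolute value is bounded through its square with a free parameter [eta], so that
   [unhit_concentration] applies. *)
have hX : `|X| <= N * eta + (N * eta)^-1 * X ^+ 2.
  have Ne : 0 < N * eta by rewrite mulr_gt0.
  have [Xs|Xb] := leP `|X| (N * eta).
    by apply: (le_trans Xs); rewrite lerDl mulr_ge0 ?sqr_ge0// invr_ge0 ltW.
  rewrite -[leLHS]add0r lerD ?(ltW Ne)// -real_normK ?num_real// mulrC.
  by rewrite ler_pdivlMr// expr2 ler_wpM2l// ltW.
have -> : B - N * q y * expR (- mass y w) = X - (N - L) * (q y * missed y w) -
   N * q y * (expR (- mass y w) - missed y w) by rewrite /X; ring.
apply: (le_trans (ler_normB _ _)); apply: lerD.
  apply: (le_trans (ler_normB _ _)); apply: lerD => //.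
  have qm : 0 <= q y * missed y w by rewrite mulr_ge0.
  rewrite ger0_norm; last by rewrite mulr_ge0// subr_ge0.
  by rewrite ler_piMr ?subr_ge0// mulr_ile1.
have d0 : 0 <= expR (- mass y w) - missed y w by rewrite subr_ge0.
rewrite ger0_norm; last by rewrite !mulr_ge0// ltW.
apply: (@le_trans _ _ (N * (c ^+ 2 / N))); last by rewrite mulrCA divff ?mulr1// gt_eqF.
rewrite -mulrA ler_wpM2l ?(ltW N0)//.
by apply: (@le_trans _ _ (expR (- mass y w) - missed y w)); [rewrite ler_piMl|lra].
Qed.

Lemma deficiency_low w :
  N - (cover_number (nbrs w))%:R = #|low w|%:R - (count (hits (low w)) (nbrs w))%:R.
Proof.
rewrite /low -deficiencyE natrD natrB ?cover_number_le_card//.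
by rewrite addrK.
Qed.

Lemma deficiency_le l (eta : R) : (l.+2 <= #|T|)%N -> 0 < eta ->
  N - mean_number l.+2 <= mean_seq demand_law l.+2 (fun w =>
      \sum_u unhit_limit (mass^~ w) u - N * \sum_y q y * two_prob (mass y w)) +
   (c * #|Y|%:R * (N * eta + (1 + 3 * N * eps l) / eta + (N - l.+2%:R) + c ^+ 2)
    + (N - l.+2%:R) + c ^+ 2 + N * C1 * eps l).
Proof.
move=> lT eta0; set L := l.+2%:R : R.
have LN : L <= N by rewrite ler_nat.
have L0 : 0 <= L by exact: ler0n.
rewrite -[X in X - _](mean_seq_cst l.+2 _ dD) -mean_seqB.
rewrite (@eq_mean_seq _ _ _ _ _ (fun w => #|low w|%:R - (count (hits (low w)) (nbrs w))%:R));
  last by move=> w _; exact: deficiency_low.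
rewrite !mean_seqB [X in _ <= _ - X + _]mean_seqZ.
have hcount := mean_count_hits l; rewrite -/L in hcount.
set H := mean_seq _ _ (fun w => \sum_y q y * two_prob (mass y w)) in hcount *.
have H01 : 0 <= H <= 1.
  apply/andP; split.
    apply: mean_seq_ge0 => // w; apply: sumr_ge0 => y _.
    by rewrite mulr_ge0// two_prob_ge0// mass_ge0.
  rewrite -[leRHS](mean_seq_cst l.+2 _ dD); apply: le_mean_seq => // w _.
  rewrite -[leRHS]dq.2; apply: ler_sum => y _.
  by rewrite ler_piMr// two_prob_le1// mass_ge0.
have hlow : mean_seq demand_law l.+2 (fun w => #|low w|%:R) <=
    mean_seq demand_law l.+2 (fun w => \sum_u unhit_limit (mass^~ w) u) +
    c * #|Y|%:R * (N * eta + (1 + 3 * N * eps l) / eta + (N - L) + c ^+ 2).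
  apply: (le_trans (mean_card_low _)).
  have Ne : 0 < N * eta by rewrite mulr_gt0.
  rewrite -mean_seq_sum.
  apply: (@le_trans _ _ (mean_seq demand_law l.+2 (fun w =>
     \sum_u unhit_limit (mass^~ w) u + c * \sum_y (N * eta + (N * eta)^-1 *
      ((unhit y w)%:R - L * (q y * missed y w)) ^+ 2 + (N - L) + c ^+ 2)))).
    apply: le_mean_seq => // w sw.
    have -> : forall a, c * a = \sum_(u : T) c / N * a.
      move=> a; by rewrite sumr_const -mulr_natl -/N; field; rewrite gt_eqF.
    rewrite -big_split; apply: ler_sum => u _.
    by have := @expR_unhit_le w eta u; rewrite sw; apply.
  rewrite mean_seqD lerD2l mean_seqZ -mulrA.
  have [y0|] := pickP (@predT Y); last first.
    move=> Y0; have := dq.2; rewrite big_pred0// => /esym/eqP.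
    by rewrite oner_eq0.
  move=> _; have c0 : 0 <= c.
    by apply: le_trans (sum_x y0); apply: sumr_ge0 => u _; have /andP[] := x01 y0 u.
  apply: ler_wpM2l => //; rewrite mean_seq_sum.
  rewrite mulr_natl -sumr_const; apply: ler_sum => y _.
  rewrite (@eq_mean_seq _ _ _ _ _ (fun w => (N * eta + (N - L) + c ^+ 2) + (N * eta)^-1 *
      ((unhit y w)%:R - L * (q y * missed y w)) ^+ 2)); last by move=> w _; ring.
  rewrite mean_seqD mean_seqZ mean_seq_cst//.
  have hX := unhit_concentration y l; rewrite -/L -/(eps l) in hX.
  have : (N * eta)^-1 * mean_seq demand_law l.+2 (fun w =>
      ((unhit y w)%:R - L * (q y * missed y w)) ^+ 2) <= (1 + 3 * N * eps l) / eta.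
    have -> : (1 + 3 * N * eps l) / eta = (N * eta)^-1 * (N + 3 * N ^+ 2 * eps l).
      by field; rewrite !gt_eqF.
    apply: ler_wpM2l; first by rewrite invr_ge0 ltW.
    apply: (le_trans hX); apply: lerD => //; apply: ler_wpM2r; first exact: eps_ge0.
    by apply: ler_wpM2l => //; rewrite lerXn2r ?nnegrE ?(ltW N0).
  lra.
have e1 : L * (c ^+ 2 / N) <= c ^+ 2.
  rewrite mulrCA ler_piMr ?sqr_ge0// ler_pdivrMr// mul1r//.
have e2 : L * (C1 * eps l) <= N * C1 * eps l.
  by rewrite -mulrA; apply: ler_wpM2r => //; rewrite mulr_ge0.
have e3 : (N - L) * H <= N - L.
  by case/andP: H01 => H0 H1; rewrite ler_piMr// subr_ge0.
lra.
Qed.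

(** The [eps] telescope with step two and gains lie in [[0, 1]], so [K] consecutive ones sum to at
    most 2. The window starts at [#|T| - K.+2] to keep [l.+2] within [K] of [#|T|]. *)
Lemma gain_pigeonhole K : (0 < K)%N -> (K.+2 <= #|T|)%N ->
  exists l, [/\ (l.+2 <= #|T|)%N, N - l.+2%:R <= K%:R & eps l <= 2 / K%:R].
Proof.
move=> K0 KT; pose l0 := (#|T| - K.+2)%N.
have tele : \sum_(j < K) eps (l0 + j) <= 2.
  have -> : \sum_(j < K) eps (l0 + j) =
      gain l0 + gain l0.+1 - gain (l0 + K) - gain (l0 + K).+1.
    elim: {KT K0} K l0 => [|K IH] l0; first by rewrite big_ord0 addn0; ring.
    by rewrite big_ord_recr /= IH /eps addnS; ring.
  have := gain_le1 l0; have := gain_le1 l0.+1.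
  by have := gain_ge0 (l0 + K); have := gain_ge0 (l0 + K).+1; lra.
have [/existsP[j hj]|/existsPn h] := boolP [exists j : 'I_K, eps (l0 + j) <= 2 / K%:R].
  exists (l0 + j)%N; split=> //; first by rewrite /l0; have := ltn_ord j; lia.
  by rewrite /N -natrB ?ler_nat /l0; have := ltn_ord j; lia.
have : \sum_(j < K) 2 / K%:R < \sum_(j < K) eps (l0 + j).
  apply: ltr_sum => [|j _]; last by rewrite ltNge h.
  by apply/hasP; exists (Ordinal K0); rewrite ?mem_index_enum.
rewrite sumr_const card_ord -[X in X < _]mulr_natr divfK ?pnatr_eq0 -?lt0n//.
by move=> /lt_le_trans/(_ tele); rewrite ltxx.
Qed.

Lemma mean_number_homo l k : (l <= k)%N -> mean_number l <= mean_number k.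
Proof.
move=> /subnK <-; elim: (k - l)%N => [//|d IH].
apply: (le_trans IH); rewrite addSn -subr_ge0; exact: gain_ge0.
Qed.

(** The mean deficiency decreases with the number of demand nodes, so it is enough to bound it at
    the [l] of [gain_pigeonhole]. There [hB] is applied to the random [mass] and averaged. *)
Lemma deficiency_upper_bound (B eta : R) K :
    (forall z, (forall y, 0 <= z y <= \sum_u x y u) ->
      \sum_u unhit_limit z u - N * \sum_y q y * two_prob (z y) <= N * B) ->
    0 < eta -> (0 < K)%N -> (K.+2 <= #|T|)%N ->
  (N - mean_number #|T|) / N <= B +
   (c * #|Y|%:R * (eta + (N^-1 + 6 / K%:R) / eta + (K%:R + c ^+ 2) / N)
    + (K%:R + c ^+ 2) / N + 2 * C1 / K%:R).
Proof.
move=> hB eta0 K0 KT; have [l [lT NL epsK]] := gain_pigeonhole K0 KT.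
have c0 : 0 <= c.
  have [y0 _|Y0] := pickP (@predT Y).
    by apply: le_trans (sum_x y0); apply: sumr_ge0 => u _; have /andP[] := x01 y0 u.
  by have := dq.2; rewrite big_pred0// => /esym/eqP; rewrite oner_eq0.
rewrite ler_pdivrMr//.
apply: (@le_trans _ _ (N - mean_number l.+2)).
  by rewrite lerD2l lerN2 mean_number_homo.
apply: (le_trans (deficiency_le lT eta0)).
rewrite [leRHS]mulrDl; apply: lerD.
  rewrite -[leRHS](mean_seq_cst l.+2 _ dD) [B * N]mulrC; apply: le_mean_seq => // w _.
  by apply: hB => y; rewrite mass_ge0 mass_le.
have cY : 0 <= c * #|Y|%:R by rewrite mulr_ge0.
have K0' : 0 < K%:R :> R by rewrite ltr0n.
have k1 : (1 + 3 * N * eps l) / eta <= (1 + 3 * N * (2 / K%:R)) / eta.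
  rewrite ler_pM2r ?invr_gt0// lerD2l; apply: ler_wpM2l => //.
  by rewrite mulr_ge0// ltW.
have k2 : N * C1 * eps l <= N * C1 * (2 / K%:R).
  by apply: ler_wpM2l => //; rewrite mulr_ge0// ltW.
have -> : (c * #|Y|%:R * (eta + (N^-1 + 6 / K%:R) / eta + (K%:R + c ^+ 2) / N)
    + (K%:R + c ^+ 2) / N + 2 * C1 / K%:R) * N =
  c * #|Y|%:R * (N * eta + (1 + 3 * N * (2 / K%:R)) / eta + K%:R + c ^+ 2)
    + K%:R + c ^+ 2 + N * C1 * (2 / K%:R).
  by field; rewrite !gt_eqF.
have k3 : c * #|Y|%:R * (N * eta + (1 + 3 * N * eps l) / eta + (N - l.+2%:R) + c ^+ 2) <=
    c * #|Y|%:R * (N * eta + (1 + 3 * N * (2 / K%:R)) / eta + K%:R + c ^+ 2).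
  by apply: ler_wpM2l => //; move: k1 NL; lra.
by move: k2 k3 NL; lra.
Qed.

End Demands.

(** * The upper bound on the matching number *)

Section Telescope.
Local Open Scope ring_scope.
Variable R : realType.

Lemma telescope_shift (g : nat -> R) K rho : (forall i, 0 <= g i <= 1) ->
  \sum_(i < K) (g i - g (i + rho)%N) <= rho%:R.
Proof.
move=> g01; elim: rho => [|rho IH].
  by rewrite big1 // => i _; rewrite addn0 subrr.
have -> : \sum_(i < K) (g i - g (i + rho.+1)%N) =
    \sum_(i < K) (g i - g (i + rho)%N) + (g rho - g (K + rho)%N).
  elim: {IH} K => [|K IH]; first by rewrite !big_ord0 add0n; ring.
  by rewrite !big_ord_recr /= IH addSn addnS; ring.
rewrite -natr1; apply: lerD => //.
by have := g01 rho; have := g01 (K + rho)%N; lra.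
Qed.

Variables (d : nat -> nat -> R) (kappa : R) (rho : nat).
Let delta l k := d l k - d l k.+1.
Hypothesis delta01 : forall l k, 0 <= delta l k <= 1.
Hypothesis deltaS : forall l k, delta l k.+1 <= delta l k.
Hypothesis step : forall l k, d l k + kappa - rho%:R * delta l k <= d l.+1 k.

Let delta_homo l k j : delta l (k + j) <= delta l k.
Proof.
elim: j => [|j IH]; first by rewrite addn0.
by rewrite addnS; apply: le_trans IH.
Qed.

Let d_homo l k j : d l (k + j) <= d l k.
Proof.
elim: j => [|j IH]; first by rewrite addn0.
apply: le_trans IH; rewrite addnS.
by have := delta01 l (k + j); rewrite /delta; lra.
Qed.

(* The step is exact only to first order in [rho * delta]; averaging over the
   offset [i < K] turns the second-order errors into a telescoping sum. *)
Lemma interpolation_step K l j :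
  \sum_(i < K) d l (j + rho + i) + (K%:R * kappa - rho%:R ^+ 2) <=
  \sum_(i < K) d l.+1 (j + i).
Proof.
(* By convexity in [k], each of the [rho] successive drops is at least [delta l (m + rho)]. *)
have drop m : d l (m + rho) <= d l m - rho%:R * delta l (m + rho).
  suff h p : (p <= rho)%N -> d l (m + p) <= d l m - p%:R * delta l (m + rho) by exact: h.
  elim: p => [|p IH] pr; first by rewrite addn0 mul0r subr0.
  have := IH (ltnW pr); have := delta_homo l (m + p) (rho - p).
  rewrite -addnA subnKC ?(ltnW pr)// addnS -natr1 /delta; lra.
have h : \sum_(i < K) (d l (j + rho + i) + kappa) - \sum_(i < K) d l.+1 (j + i) <=
    rho%:R * \sum_(i < K) (delta l (j + i) - delta l (j + (i + rho))).
  rewrite -sumrB mulr_sumr; apply: ler_sum => i _.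
  have := step l (j + i); have := drop (j + i)%N.
  rewrite [(j + (i + rho))%N]addnA [(j + rho + i)%N]addnAC; lra.
have := @telescope_shift (fun i => delta l (j + i)) K rho (fun i => delta01 _ _).
have : \sum_(i < K) (d l (j + rho + i) + kappa) =
   \sum_(i < K) d l (j + rho + i) + K%:R * kappa.
  by rewrite big_split /= sumr_const card_ord mulr_natl.
have := ler0n R rho; move: h; move: (\sum_(i < K) (delta _ _ - _)) => S.
by nra.
Qed.

(** Each step in [l] is traded for [rho] steps in [k], so [n] steps link the window of width [K] at
    [n * rho] with the one at 0. Monotonicity in [k] replaces these windows by their extreme
    values. *)
Lemma interpolation K n : K%:R * d 0 (n * rho + K) + n%:R * (K%:R * kappa - rho%:R ^+ 2)
  <= K%:R * d n 0.
Proof.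
have h l j : \sum_(i < K) d 0 (j + l * rho + i) + l%:R * (K%:R * kappa - rho%:R ^+ 2) <=
    \sum_(i < K) d l (j + i).
  elim: l j => [|l IH] j; first by rewrite mul0n addn0 mul0r addr0.
  apply: le_trans (interpolation_step K l j); have := IH (j + rho)%N.
  rewrite mulSn addnA -natr1; lra.
apply: le_trans (le_trans _ (h n 0%N)) _.
- rewrite lerD2r mulr_natl -[X in _ *+ X](card_ord K) -sumr_const; apply: ler_sum => i _.
  have := d_homo 0 (n * rho + i) (K - i).
  by rewrite add0n -addnA subnKC// ltnW.
- rewrite mulr_natl -[X in _ *+ X](card_ord K) -sumr_const; apply: ler_sum => i _.
  exact: d_homo.
Qed.

End Telescope.

Lemma big_option (R : nmodType) (T : finType) (f : option T -> R) :
  (\sum_o f o = f None + \sum_u f (Some u))%R.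
Proof.
rewrite (bigD1 None)//=; congr (_ + _)%R.
rewrite (reindex_omap Some id) => [|[u|]//].
by apply: eq_bigl => u; rewrite eqxx.
Qed.

(** * Replacing demand nodes by pendant ones *)

Section Interpolation.
Local Open Scope ring_scope.
Variables (R : realType) (T Y : finType) (q : Y -> R) (x : Y -> T -> R).
Hypothesis dq : distribution q.
Hypothesis x01 : forall y u, 0 <= x y u <= 1.
Variable c : R.
Hypothesis sum_x : forall y, \sum_u x y u <= c.
Hypothesis x_le : forall y u, x y u <= c / #|T|%:R.
Hypothesis T0 : (0 < #|T|)%N.
Variables (b : Y -> R) (rho : nat).
Hypothesis b0 : forall y, 0 <= b y.
Hypothesis c_rho : c <= rho%:R.
Hypothesis rho0 : (0 < rho)%N.

Let N : R := #|T|%:R.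
Let N0 : 0 < N. Proof. by rewrite ltr0n. Qed.
Let rhoR0 : 0 < rho%:R :> R. Proof. by rewrite ltr0n. Qed.
Let dD := demand_law_distribution dq x01.
Let D := demand_law q x.

(** The mean number of pendant nodes at [u] once all [N] demand nodes are replaced; [b y] plays the
    role of [M_y t_y]. *)
Definition leaf_rate u : R := \sum_y N * x y u * q y * expR (- b y).

(** Each demand node is traded for [rho] pendant ones; [c <= rho%:R] keeps every probability below
    [1 / N], so that their sum is at most 1. *)
Definition leaf_prob u : R := leaf_rate u / (N * rho%:R).

(* The value [None] stands for a pendant demand node without neighbour. *)
Definition leaf_law (o : option T) : R :=
  if o is Some u then leaf_prob u else 1 - \sum_u leaf_prob u.

Definition leaf_set (o : option T) : {set T} :=
  if o is Some u then [set u]%SET else finset.set0.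

Lemma leaf_rate_ge0 u : 0 <= leaf_rate u.
Proof.
apply: sumr_ge0 => y _; have /andP[x0 _] := x01 y u.
by rewrite !mulr_ge0 ?expR_ge0 ?dq.1// ltW.
Qed.

Lemma leaf_rate_le u : leaf_rate u <= rho%:R.
Proof.
apply: le_trans c_rho; rewrite -[leRHS]mulr1 -dq.2 mulr_sumr; apply: ler_sum => y _.
have /andP[x0 _] := x01 y u; have q0 : 0 <= q y := dq.1 y.
have h : N * x y u <= c by have := x_le y u; rewrite ler_pdivlMr// mulrC.
have e1 : expR (- b y) <= 1 by rewrite -[leRHS](@expR0 R) ler_expR oppr_le0.
apply: (@le_trans _ _ (N * x y u * q y)); last exact: ler_wpM2r.
by rewrite ler_piMr// !mulr_ge0// ltW.
Qed.

Lemma leaf_prob_ge0 u : 0 <= leaf_prob u.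
Proof. by rewrite divr_ge0 ?leaf_rate_ge0// mulr_ge0// ltW. Qed.

Lemma leaf_prob_le u : leaf_prob u <= N^-1.
Proof.
rewrite ler_pdivrMr ?mulr_gt0// mulKf ?gt_eqF//; exact: leaf_rate_le.
Qed.

Lemma leaf_law_distribution : distribution leaf_law.
Proof.
have s1 : \sum_u leaf_prob u <= 1.
  apply: (@le_trans _ _ (\sum_(u : T) N^-1)).
    by apply: ler_sum => u _; exact: leaf_prob_le.
  by rewrite sumr_const -mulr_natl divff// gt_eqF.
split=> [[u|]|]; [exact: leaf_prob_ge0|by rewrite subr_ge0|].
by rewrite big_option /= subrK.
Qed.

Definition pinned (w : seq (Y * {set T})) (s : seq (option T)) : seq {set T} :=
  nbrs w ++ map leaf_set s.

Definition pinned_mean l k (phi : seq {set T} -> R) : R :=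
  mean_seq D l (fun w => mean_seq leaf_law k (fun s => phi (pinned w s))).

Let dL := leaf_law_distribution.

Lemma le_pinned_mean l k phi psi : (forall G, phi G <= psi G) ->
  pinned_mean l k phi <= pinned_mean l k psi.
Proof. by move=> h; apply: le_mean_seq => // w _; apply: le_mean_seq. Qed.

Lemma eq_pinned_mean l k phi psi : (forall G, phi G = psi G) ->
  pinned_mean l k phi = pinned_mean l k psi.
Proof. by move=> h; apply: eq_mean_seq => w _; apply: eq_mean_seq. Qed.

Lemma pinned_meanD l k phi psi :
  pinned_mean l k (fun G => phi G + psi G) = pinned_mean l k phi + pinned_mean l k psi.
Proof. by rewrite -mean_seqD; apply: eq_mean_seq => w _; rewrite mean_seqD. Qed.

Lemma pinned_meanB l k phi psi :
  pinned_mean l k (fun G => phi G - psi G) = pinned_mean l k phi - pinned_mean l k psi.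
Proof. by rewrite -mean_seqB; apply: eq_mean_seq => w _; rewrite mean_seqB. Qed.

Lemma pinned_meanZ l k a phi : pinned_mean l k (fun G => a * phi G) = a * pinned_mean l k phi.
Proof. by rewrite -mean_seqZ; apply: eq_mean_seq => w _; rewrite mean_seqZ. Qed.

Lemma pinned_mean_cst l k a : pinned_mean l k (fun=> a) = a.
Proof.
rewrite /pinned_mean (@eq_mean_seq _ _ _ _ _ (fun=> a)) ?mean_seq_cst//.
Qed.

Lemma pinned_meanSl l k phi :
  pinned_mean l.+1 k phi = pinned_mean l k (fun G => mean D (fun v => phi (v.2 :: G))).
Proof.
rewrite /pinned_mean mean_seqS; apply: eq_mean_seq => w _.
by rewrite mean_seq_exchange.
Qed.

Lemma pinned_meanSr l k phi : (forall G H, perm_eq G H -> phi G = phi H) ->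
  pinned_mean l k.+1 phi =
  pinned_mean l k (fun G => mean leaf_law (fun o => phi (leaf_set o :: G))).
Proof.
move=> hphi; apply: eq_mean_seq => w _; rewrite mean_seqS.
apply: eq_mean_seq => s _; apply: eq_mean => o; apply: hphi.
by rewrite /pinned /= -cat_rcons -cats1 -catA perm_catCA.
Qed.

Definition pinned_deficiency l k : R :=
  pinned_mean l k (fun G => N - (cover_number G)%:R).

Lemma pinned_deficiency_leaf l k :
  pinned_deficiency l k - pinned_deficiency l k.+1 =
  pinned_mean l k (fun G => \sum_(u in least_optimal G) leaf_prob u).
Proof.
rewrite {2}/pinned_deficiency pinned_meanSr; last first.
  by move=> G H GH; rewrite (perm_cover_number GH).
apply/eqP; rewrite subr_eq; apply/eqP; rewrite -pinned_meanD; apply: eq_pinned_mean => G.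
rewrite -[LHS](mean_cst _ dL) big_mkcond /=.
have -> : \sum_u (if u \in least_optimal G then leaf_prob u else 0) =
    mean leaf_law (fun o => (hits (least_optimal G) (leaf_set o))%:R).
  rewrite /mean big_option /= (_ : hits _ finset.set0 = false); last first.
    by apply/hitsP => -[u]; rewrite finset.in_set0.
  rewrite mulr0 add0r; apply: eq_bigr => u _; rewrite hits_set1.
  by case: ifP => _; rewrite ?mulr1 ?mulr0.
rewrite -meanD; apply: eq_mean => o.
by rewrite cover_number_cons natrD; ring.
Qed.

(** The hypothesis [step] of the interpolation. With [z] the mean number of neighbours in the least
    optimal set, the tangent line gives [expR (- z) >= expR (- b y) * (1 + b y - z)]; averaged over
    [y], the part linear in [z] is exactly the effect of [rho] pendant nodes. *)
Lemma pinned_deficiency_demand l k :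
  pinned_deficiency l k + (\sum_y q y * expR (- b y) * (1 + b y) - 1 - c ^+ 2 / N)
   - rho%:R * (pinned_deficiency l k - pinned_deficiency l k.+1)
  <= pinned_deficiency l.+1 k.
Proof.
rewrite pinned_deficiency_leaf /pinned_deficiency [leRHS]pinned_meanSl.
rewrite -pinned_meanZ -[X in _ + X - _](pinned_mean_cst l k) -pinned_meanD -pinned_meanB.
apply: le_pinned_mean => G.
rewrite (@eq_mean _ _ _ _ (fun v => (N - (cover_number G)%:R) - (hits (least_optimal G) v.2)%:R));
  last by move=> v; rewrite cover_number_cons natrD opprD addrA.
rewrite meanB mean_cst// -addrA lerD2l mean_demand.
set A := least_optimal G.
rewrite [X in _ <= - X](eq_bigr (fun y => q y * (1 - miss (x y) A))); last first.
  move=> y _; congr (_ * _); have dR := random_set_distribution (x01 y).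
  rewrite -mean_hitsN// -[X in X - _](mean_cst 1 dR) -meanB; apply: eq_mean => M /=.
  by case: hits => /=; lra.
have -> : - \sum_y q y * (1 - miss (x y) A) = \sum_y q y * miss (x y) A - 1.
  by rewrite -[X in _ - X]dq.2 -sumrB -sumrN; apply: eq_bigr => y _; ring.
have -> : rho%:R * \sum_(u in A) leaf_prob u =
    \sum_y q y * (expR (- b y) * \sum_(u in A) x y u).
  rewrite mulr_sumr.
  under [RHS]eq_bigr do rewrite mulrA mulr_sumr.
  rewrite exchange_big; apply: eq_bigr => u _ /=.
  rewrite /leaf_prob /leaf_rate mulr_suml mulr_sumr; apply: eq_bigr => y _.
  by field; rewrite !gt_eqF.
have h y : expR (- b y) * (1 + b y) - c ^+ 2 / N - expR (- b y) * \sum_(u in A) x y u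
    <= miss (x y) A.
  apply: le_trans (miss_ge_expR (x01 y) A).
  have := sum_sqr_x x01 sum_x x_le y A; rewrite -/N.
  set z := \sum_(u in A) x y u.
  have -> : expR (- z) = expR (- b y) * expR (b y - z) by rewrite -expRD; congr expR; ring.
  have := ler_wpM2l (expR_ge0 (- b y)) (expR_ge1Dx (b y - z)); lra.
have : \sum_y q y * (expR (- b y) * (1 + b y) - c ^+ 2 / N -
    expR (- b y) * \sum_(u in A) x y u) <= \sum_y q y * miss (x y) A.
  by apply: ler_sum => y _; rewrite ler_wpM2l// dq.1.
under eq_bigr do rewrite !mulrBr.
by rewrite !sumrB -[X in _ - X - _]mulr_suml dq.2 mul1r;
  under eq_bigr do rewrite mulrA; lra.
Qed.

Lemma pinned_deficiency_diff01 l k :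
  0 <= pinned_deficiency l k - pinned_deficiency l k.+1 <= 1.
Proof.
rewrite pinned_deficiency_leaf; apply/andP; split.
  rewrite -[leLHS](pinned_mean_cst l k); apply: le_pinned_mean => G.
  by apply: sumr_ge0 => u _; exact: leaf_prob_ge0.
rewrite -[leRHS](pinned_mean_cst l k); apply: le_pinned_mean => G.
apply: (@le_trans _ _ (\sum_(u : T) N^-1)); last first.
  by rewrite sumr_const -mulr_natl divff// gt_eqF.
rewrite [leRHS](bigID (mem (least_optimal G))) /=; apply: ler_wpDr.
  by apply: sumr_ge0 => u _; rewrite invr_ge0 ltW.
by apply: ler_sum => u _; exact: leaf_prob_le.
Qed.

Lemma pinned_deficiency_convex l k :
  pinned_deficiency l k.+1 - pinned_deficiency l k.+2 <=
  pinned_deficiency l k - pinned_deficiency l k.+1.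
Proof.
rewrite !pinned_deficiency_leaf pinned_meanSr; last first.
  by move=> G H GH; rewrite (perm_least_optimal GH).
apply: le_pinned_mean => G; rewrite -[leRHS](mean_cst _ dL); apply: le_mean => // o.
rewrite big_mkcond [leRHS]big_mkcond; apply: ler_sum => u _ /=.
have /fintype.subsetP/(_ u) := least_optimal_cons_sub G (leaf_set o).
by case: (u \in _) => [->//|_]; case: ifP => // _; exact: leaf_prob_ge0.
Qed.

Lemma pinned_deficiency_leaves k :
  \sum_u (1 - leaf_prob u) ^+ k <= pinned_deficiency 0 k.
Proof.
rewrite /pinned_deficiency /pinned_mean /= /pinned /=.
have -> : \sum_u (1 - leaf_prob u) ^+ k =
    mean_seq leaf_law k (fun s => \sum_u \prod_(o <- s) (o != Some u)%:R).
  rewrite mean_seq_sum; apply: eq_bigr => u _; rewrite mean_seq_prod; congr (_ ^+ _).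
  have -> : mean leaf_law (fun o => (o != Some u)%:R) =
      mean leaf_law (fun o => 1 - (o == Some u)%:R).
    by apply: eq_mean => o; case: eqP => _ /=; rewrite ?subrr ?subr0.
  rewrite meanB mean_cst//; congr (_ - _).
  rewrite /mean (bigD1 (Some u))//= eqxx mulr1 big1 ?addr0// => o /negbTE ->.
  by rewrite mulr0.
apply: le_mean_seq => // s _.
(* The supply nodes without a pendant node: no pendant node hits this set, so its cost is the size
   of its complement. *)
pose A := [set u | Some u \notin s]%SET.
have -> : \sum_u \prod_(o <- s) (o != Some u)%:R = #|A|%:R :> R.
  rewrite -sum1_card natr_sum [RHS]big_mkcond; apply: eq_bigr => u _.
  rewrite finset.inE; case: (boolP (Some u \in s)) => us /=.
    by rewrite (big_rem _ us) /= eqxx mul0r.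
  by rewrite big_seq big1// => o os; case: eqP => // ou; rewrite -ou os in us.
have := cover_number_le (map leaf_set s) A; rewrite /cover_cost.
have -> : count (hits A) (map leaf_set s) = 0%N.
  apply/eqP; rewrite -leqn0 leqNgt -has_count; apply/hasPn => _ /mapP[i si ->].
  apply/hitsP => -[u]; case: i si => [w|] si /=; last by rewrite finset.in_set0.
  by move=> /finset.set1P ->; rewrite finset.inE si.
rewrite addn0 -(ler_nat R) => h.
have : #|T|%:R = #|A|%:R + #|~: A|%:R :> R by rewrite -natrD cardsC.
by rewrite /N; move=> ->; lra.
Qed.

Lemma leaf_prob_exprn K u : expR (- leaf_rate u) - (2 * K%:R + rho%:R) / N <=
  (1 - leaf_prob u) ^+ (#|T| * rho + K).
Proof.
set m := (_ + K)%N; set p := leaf_prob u.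
have p0 : 0 <= p := leaf_prob_ge0 u.
have p1 : p <= N^-1 := leaf_prob_le u.
have Ninv1 : N^-1 <= 1 by rewrite invf_le1// /N ler1n.
have p01 : forall i : 'I_m, 0 <= p <= 1 by move=> _; rewrite p0 (le_trans p1).
(* [(1 - p) ^+ m] is [miss] of the full set for [m] equal probabilities; the [K] surplus pendant
   nodes shift the mean by at most [K%:R / N]. *)
have := miss_ge_expR p01 [set: 'I_m]%SET.
rewrite /miss prodr_const !sumr_const finset.cardsT card_ord => h.
clear p01.
apply: le_trans h; rewrite -[p *+ m]mulr_natl -[p ^+ 2 *+ m]mulr_natl.
have Nm : m%:R = N * rho%:R + K%:R by rewrite /m natrD natrM.
have -> : m%:R * p = leaf_rate u + K%:R * p.
  by rewrite Nm mulrDl /p /leaf_prob; congr (_ + _); field; rewrite !gt_eqF.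
have Kp : K%:R * p <= K%:R / N by apply: ler_wpM2l.
have h1 : expR (- leaf_rate u) - K%:R / N <= expR (- (leaf_rate u + K%:R * p)).
  rewrite opprD expRD; have := expR_ge1Dx (- (K%:R * p)).
  have : expR (- leaf_rate u) <= 1 by rewrite -[leRHS](@expR0 R) ler_expR oppr_le0 leaf_rate_ge0.
  have := expR_ge0 (- leaf_rate u); have : 0 <= K%:R * p by rewrite mulr_ge0.
  by move: Kp; move: (K%:R * p) (K%:R / N) (expR (- leaf_rate u)) (expR _) => a a' e e'; nra.
have h2 : m%:R * p ^+ 2 <= (K%:R + rho%:R) / N.
  apply: (@le_trans _ _ (m%:R * (N^-1) ^+ 2)).
    by rewrite ler_wpM2l// lerXn2r// nnegrE invr_ge0 ltW.
  rewrite Nm expr2 mulrDl.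
  have -> : N * rho%:R * (N^-1 * N^-1) = rho%:R / N by field; rewrite gt_eqF.
  rewrite [leRHS]mulrDl addrC lerD2r mulrA ler_piMr// divr_ge0// ltW.
move: h1 h2; rewrite !mulrDl; lra.
Qed.

Lemma deficiency_lower_bound K : (0 < K)%N ->
  (\sum_u expR (- leaf_rate u)) / N + \sum_y q y * expR (- b y) * (1 + b y) - 1
   - ((2 * K%:R + rho%:R + c ^+ 2) / N + rho%:R ^+ 2 / K%:R)
  <= (N - mean_number q x #|T|) / N.
Proof.
move=> K0; have KR : 0 < K%:R :> R by rewrite ltr0n.
have := interpolation pinned_deficiency_diff01 pinned_deficiency_convex
  pinned_deficiency_demand K #|T|.
have -> : pinned_deficiency #|T| 0 = N - mean_number q x #|T|.
  rewrite /pinned_deficiency /mean_number -[X in X - _](mean_seq_cst #|T| _ dD) -mean_seqB.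
  by apply: eq_mean_seq => w _; rewrite /= /pinned cats0.
rewrite -/N; set kap := \sum_y _; move=> hint.
have h0 : \sum_u expR (- leaf_rate u) - (2 * K%:R + rho%:R) <=
    pinned_deficiency 0 (#|T| * rho + K).
  apply: le_trans (pinned_deficiency_leaves _).
  have -> : 2 * K%:R + rho%:R = \sum_(u : T) (2 * K%:R + rho%:R) / N.
    by rewrite sumr_const -[RHS]mulr_natl -/N mulrCA divff ?mulr1// gt_eqF.
  by rewrite -sumrB; apply: ler_sum => u _; exact: leaf_prob_exprn.
rewrite ler_pdivlMr// -(ler_pM2l KR); apply: le_trans hint.
have := ler_wpM2l (ltW KR) h0; move: (pinned_deficiency _ _) => P h1.
set S := \sum_u _ in h1 *.
rewrite [leLHS](_ : _ = K%:R * (S - (2 * K%:R + rho%:R)) +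
  N * (K%:R * (kap - 1 - c ^+ 2 / N) - rho%:R ^+ 2)) ?lerD2r//.
by field; rewrite !gt_eqF.
Qed.

End Interpolation.

(** * König's theorem *)

Section Konig.
Variables S D : finType.
Implicit Types (E M : {set S * D}) (A : {set S}) (u : S) (d : D).

Definition supply_nbr E d : {set S} := [set u | (u, d) \in E]%SET.

Definition nbr_seq E : seq {set S} := [seq supply_nbr E d | d <- enum D].

Lemma hits_supply_nbrP E A d :
  reflect (exists2 u, (u, d) \in E & u \in A) (hits A (supply_nbr E d)).
Proof.
by apply: (iffP (hitsP _ _)) => -[u]; rewrite ?finset.inE => uE uA; exists u;
  rewrite ?finset.inE.
Qed.

Lemma count_nbr_seq E A :
  count (hits A) (nbr_seq E) = #|[set d | hits A (supply_nbr E d)]%SET|.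
Proof.
rewrite /nbr_seq count_map -size_filter cardE; congr size.
rewrite /enum_mem -filter_predI; apply: eq_filter => d /=.
by rewrite finset.inE andbT.
Qed.

(** An edge of [M] is charged to its supply end if that lies outside [A], and to its demand end
    otherwise; both charges are injective on a matching. *)
Lemma card_matching_le E M : is_matching E M -> #|M| <= cover_number (nbr_seq E).
Proof.
move=> /andP[/fintype.subsetP ME /forall_inP MM].
have inj e f : e \in M -> f \in M -> (e.1 == f.1) || (e.2 == f.2) -> e = f.
  by move=> eM fM ef; have /forall_inP/(_ f fM)/implyP/(_ ef)/eqP := MM e eM.
set A := [arg min_(A < finset.set0) cover_cost (nbr_seq E) A].
rewrite -[cover_number _]/(cover_cost (nbr_seq E) A) /cover_cost count_nbr_seq.
move: A => A; rewrite -(cardsID [set e | e.1 \in A]%SET M) addnC; apply: leq_add.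
  rewrite -(@card_in_imset _ _ (fun e : S * D => e.1)) => [|e f]; last first.
    by rewrite !finset.inE => /andP[_ eM] /andP[_ fM] ef; apply: inj => //; rewrite ef eqxx.
  apply/subset_leq_card/fintype.subsetP => u /imsetP[e]; rewrite !finset.inE.
  by move=> /andP[eA _] ->.
rewrite -(@card_in_imset _ _ (fun e : S * D => e.2)) => [|e f]; last first.
  rewrite !finset.inE => /andP[eM _] /andP[fM _] ef; apply: inj => //.
  by rewrite ef eqxx orbT.
apply/subset_leq_card/fintype.subsetP => d /imsetP[e]; rewrite !finset.inE.
move=> /andP[eM eA] ->; apply/hits_supply_nbrP; exists e.1 => //.
by rewrite -surjective_pairing; exact: ME.
Qed.

Lemma perm_nbr_seq E d :
  perm_eq (nbr_seq E) (supply_nbr E d :: [seq supply_nbr E d' | d' <- rem d (enum D)]).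
Proof.
rewrite -[_ :: _]/(map (supply_nbr E) (d :: rem d (enum D))); apply: perm_map.
by apply: perm_to_rem; rewrite mem_enum.
Qed.

Lemma supply_nbr_setD1 E u d d' :
  supply_nbr (E :\ (u, d))%SET d' = if d' == d then (supply_nbr E d :\ u)%SET else supply_nbr E d'.
Proof.
apply/setP => t; rewrite !finset.inE xpair_eqE; case: ifP => [/eqP ->|hd].
  by rewrite andbT !finset.inE.
by rewrite andbF finset.inE.
Qed.

(** By [cover_number_cons], only whether [d] hits the least optimal set of the remaining graph
    matters. Of two edges at [d], one can be deleted without changing this. *)
Lemma cover_number_setD1 E d : 1 < #|supply_nbr E d| ->
  exists2 u, (u, d) \in E &
    cover_number (nbr_seq (E :\ (u, d))%SET) = cover_number (nbr_seq E).
Proof.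
move=> card2; pose G := [seq supply_nbr E d' | d' <- rem d (enum D)].
have coverE u : cover_number (nbr_seq (E :\ (u, d))%SET) =
    cover_number ((supply_nbr E d :\ u)%SET :: G).
  rewrite (perm_cover_number (perm_nbr_seq _ d)) supply_nbr_setD1 eqxx.
  congr (cover_number (_ :: _)); apply/eq_in_map => d'.
  by rewrite mem_rem_uniq ?enum_uniq// finset.inE => /andP[/negbTE hd _];
    rewrite supply_nbr_setD1 hd.
suff [u uE hu] : exists2 u, u \in supply_nbr E d &
    hits (least_optimal G) (supply_nbr E d :\ u)%SET = hits (least_optimal G) (supply_nbr E d).
  exists u; first by rewrite finset.inE in uE.
  by rewrite coverE (perm_cover_number (perm_nbr_seq E d)) !cover_number_cons hu.
have sub u : hits (least_optimal G) (supply_nbr E d :\ u)%SET ->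
    hits (least_optimal G) (supply_nbr E d).
  by move=> /hitsP[t]; rewrite finset.in_setD1 => /andP[_ tE] tA; apply/hitsP; exists t.
case: (boolP (hits (least_optimal G) (supply_nbr E d))) => [/hitsP[t tE tA]|h].
  have /card_gt1P[u [u' [uE u'E uu']]] := card2.
  have [v vE vt] : exists2 v, v \in supply_nbr E d & v != t.
    have [ut|ut] := eqVneq u t; last by exists u.
    by exists u' => //; rewrite -ut eq_sym.
  exists v => //; apply/hitsP; exists t => //.
  by rewrite finset.in_setD1 eq_sym vt.
have /card_gt1P[u [_ [uE _ _]]] := card2.
by exists u => //; apply/negbTE; apply: contra h; exact: sub.
Qed.

(** Up to isolated nodes the graph is a union of stars centred at supply nodes: one edge per star is
    a matching, and the centres form a cover of the same size. *)
Lemma matching_of_small_nbr E : (forall d, #|supply_nbr E d| <= 1) ->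
  exists2 M, is_matching E M & cover_number (nbr_seq E) <= #|M|.
Proof.
move=> small; pose U := [set u | [exists d, (u, d) \in E]]%SET.
pose M := [set e in E | [pick d | (e.1, d) \in E] == Some e.2]%SET.
exists M.
  apply/andP; split.
    by apply/fintype.subsetP => e; rewrite finset.inE => /andP[].
  apply/forall_inP => e; rewrite finset.inE => /andP[eE /eqP pe].
  apply/forall_inP => f; rewrite finset.inE => /andP[fE /eqP pf].
  apply/implyP => /orP[/eqP ef|/eqP ef].
    rewrite ef pf in pe; case: pe => ef2; apply/eqP.
    by rewrite [e]surjective_pairing [f]surjective_pairing ef ef2.
  have /fintype.card_le1_eqP/(_ e.1 f.1) := small e.2.
  rewrite !finset.inE {2}ef -!surjective_pairing => /(_ eE fE) ef1.
  by apply/eqP; rewrite [e]surjective_pairing [f]surjective_pairing ef ef1.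
apply: leq_trans (cover_number_le _ (~: U)%SET) _; rewrite /cover_cost finset.setCK.
rewrite (_ : count _ _ = 0) ?addn0; last first.
  apply/eqP; rewrite -leqn0 leqNgt -has_count; apply/hasPn => _ /mapP[d _ ->].
  apply/hits_supply_nbrP => -[u uE]; rewrite !finset.inE => /existsPn/(_ d).
  by rewrite uE.
apply: leq_trans (leq_imset_card fst M); apply/subset_leq_card/fintype.subsetP => u.
rewrite finset.inE => /existsP[d0 ud0]; apply/imsetP.
case hd: [pick d | (u, d) \in E] => [d|]; last first.
  by move: hd; case: pickP => // /(_ d0); rewrite ud0.
have ud : (u, d) \in E by move: hd; case: pickP => // d' ud' [<-].
by exists (u, d) => //; rewrite finset.inE ud /= hd eqxx.
Qed.

(** For the hard inequality, a subgraph with the same cover number and fewest edges is taken; there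
    every demand node has degree at most 1. *)
Lemma max_matchingE E : max_matching E = cover_number (nbr_seq E).
Proof.
apply/eqP; rewrite eqn_leq; apply/andP; split.
  by apply/bigmax_leqP => M; exact: card_matching_le.
pose P E' := (E' \subset E) && (cover_number (nbr_seq E') == cover_number (nbr_seq E)).
have PE : P E by rewrite /P fintype.subxx eqxx.
have [E' /andP[sE' /eqP cE'] minE'] := @arg_minnP _ E P (fun E' => #|E'|) PE.
have small d : #|supply_nbr E' d| <= 1.
  rewrite leqNgt; apply/negP => /cover_number_setD1[u uE' cu].
  have := minE' (E' :\ (u, d))%SET; rewrite /P cu cE' eqxx andbT.
  rewrite (fintype.subset_trans _ sE') ?finset.subD1set// => /(_ isT).
  by rewrite (finset.cardsD1 (u, d) E') uE' add1n ltnn.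
have [M /andP[ME' MM] cM] := matching_of_small_nbr small.
rewrite -cE'; apply: leq_trans cM _.
apply: (leq_bigmax_cond (F := fun M : {set S * D} => #|M|)).
by rewrite /is_matching MM (fintype.subset_trans ME').
Qed.

End Konig.

(** * The random compatibility graph *)

Section CompatibilityGraph.
Local Open Scope ring_scope.
Variables (R : realType) (bL bR : R) (C : 'M[R]_2).

Lemma type_prob_distribution (b : R) : 0 <= b <= 1 -> distribution (type_prob b).
Proof.
move=> /andP[b0 b1]; split=> [x|]; first by rewrite /type_prob; case: ifP; rewrite ?subr_ge0.
by rewrite big_ord_recl big_ord1 /type_prob /= subrK.
Qed.

Definition rate n (s : 'I_n -> 'I_2) (y : 'I_2) (u : 'I_n) : R := edge_prob C n (s u) y.

(** For fixed supply types, demand types and edges amount to a type and a neighbourhood for each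
    demand node, and these pairs are independent with law [demand_law]. *)
Lemma mean_number_graph n (s : {ffun 'I_n -> 'I_2}) :
  mean_number (type_prob bR) (rate s) n =
  \sum_(d : {ffun 'I_n -> 'I_2}) \sum_(E : {set 'I_n * 'I_n})
    (\prod_(j < n) type_prob bR (d j)) *
    (\prod_(e : 'I_n * 'I_n)
       (if e \in E then edge_prob C n (s e.1) (d e.2)
        else 1 - edge_prob C n (s e.1) (d e.2))) * (max_matching E)%:R.
Proof.
rewrite pair_bigA /mean_number -mean_seq_ffun.
pose h (p : {ffun 'I_n -> 'I_2} * {set 'I_n * 'I_n}) : {ffun 'I_n -> 'I_2 * {set 'I_n}} :=
  [ffun j => (p.1 j, supply_nbr p.2 j)].
rewrite (reindex h) /=; last first.
  exists (fun f : {ffun 'I_n -> 'I_2 * {set 'I_n}} =>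
    ([ffun j => (f j).1], [set e | e.1 \in (f e.2).2]%SET)) => [[d E] _|f _].
    congr (_, _); first by apply/ffunP => j; rewrite !ffunE.
    by apply/setP => -[u j]; rewrite finset.inE ffunE /= finset.inE.
  apply/ffunP => j; rewrite !ffunE /= [RHS]surjective_pairing; congr (_, _).
  by apply/setP => u; rewrite !finset.inE.
apply: eq_bigr => -[d E] _ /=; congr (_ * _); last first.
  rewrite max_matchingE; congr ((cover_number _)%:R).
  by rewrite /nbrs -map_comp; apply: eq_map => j; rewrite /= ffunE.
pose f u j := if (u, j) \in E then edge_prob C n (s u) (d j)
  else 1 - edge_prob C n (s u) (d j).
rewrite [X in _ = _ * X](eq_bigr (fun e => f e.1 e.2)) => [|[]//].
rewrite -(pair_bigA _ f) /= exchange_big -big_split /=.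
apply: eq_bigr => j _; rewrite ffunE /demand_law /=; congr (_ * _).
by apply: eq_bigr => u _; rewrite finset.inE.
Qed.

Lemma mean_max_matchingE n : mean_max_matching bL bR C n =
  \sum_(s : {ffun 'I_n -> 'I_2}) (\prod_i type_prob bL (s i)) *
    mean_number (type_prob bR) (rate s) n.
Proof.
transitivity (\sum_(sd : {ffun 'I_n -> 'I_2} * {ffun 'I_n -> 'I_2})
    \sum_(E : {set 'I_n * 'I_n})
      graph_prob bL bR C (sd, E) * (max_matching E)%:R).
  by rewrite [RHS]pair_bigA; apply: eq_bigr => -[].
transitivity (\sum_(s : {ffun 'I_n -> 'I_2}) \sum_(d : {ffun 'I_n -> 'I_2})
    \sum_(E : {set 'I_n * 'I_n})
      graph_prob bL bR C (s, d, E) * (max_matching E)%:R).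
  by rewrite [RHS]pair_bigA; apply: eq_bigr => -[].
apply: eq_bigr => s _; rewrite mean_number_graph mulr_sumr; apply: eq_bigr => d _.
by rewrite mulr_sumr; apply: eq_bigr => E _ /=; rewrite !mulrA.
Qed.

End CompatibilityGraph.

(** * Concentration of the type counts *)

Section Concentration.
Local Open Scope ring_scope.
Variables (R : realType) (V : finType) (P : V -> R).
Hypothesis dP : distribution P.

(** The binomial variance: each draw adds [P v * (1 - P v) <= 1]. *)
Lemma mean_count_sqr l v :
  mean_seq P l (fun w => ((count_mem v w)%:R - l%:R * P v) ^+ 2) <= l%:R.
Proof.
have Pv1 : P v <= 1 by rewrite -dP.2 (bigD1 v)//= lerDl sumr_ge0// => a _; exact: dP.1.
have Pv0 : 0 <= P v by exact: dP.1.
elim: l => [|l IH]; first by rewrite /= mul0r subrr expr0n.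
rewrite mean_seqS.
rewrite (@eq_mean_seq _ _ _ _ _ (fun w => ((count_mem v w)%:R - l%:R * P v) ^+ 2 +
   P v * (1 - P v))); last first.
  move=> w _; set X := (count_mem v w)%:R.
  rewrite (@eq_mean _ _ _ _ (fun a => (1 + 2 * (X - l.+1%:R * P v)) * (a == v)%:R +
     (X - l.+1%:R * P v) ^+ 2)).
    rewrite meanD mean_cst// meanZ -natr1 /mean (bigD1 v)//= eqxx big1 => [|a /negbTE ->].
      by rewrite /=; ring.
    by rewrite mulr0.
  by move=> a; rewrite /= natrD -/X; case: (a == v) => /=; ring.
rewrite mean_seqD mean_seq_cst// -natr1; apply: lerD => //; nra.
Qed.

Lemma mean_count_dev l v (eta : R) : (0 < l)%N -> 0 < eta ->
  mean_seq P l (fun w => `|(count_mem v w)%:R / l%:R - P v|) <= eta + (l%:R * eta)^-1.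
Proof.
move=> l0 eta0; have L0 : 0 < l%:R :> R by rewrite ltr0n.
apply: (@le_trans _ _ (mean_seq P l (fun w => eta +
    (l%:R ^+ 2 * eta)^-1 * ((count_mem v w)%:R - l%:R * P v) ^+ 2))).
  apply: le_mean_seq => // w _; set X := _ - l%:R * _.
  have -> : (count_mem v w)%:R / l%:R - P v = X / l%:R.
    by rewrite /X; field; rewrite gt_eqF.
  have -> : (l%:R ^+ 2 * eta)^-1 * X ^+ 2 = eta^-1 * (X / l%:R) ^+ 2.
    by field; rewrite !gt_eqF.
  move: (X / l%:R) => Z; have [Zs|Zb] := leP `|Z| eta.
    by apply: (le_trans Zs); rewrite lerDl mulr_ge0 ?sqr_ge0// invr_ge0 ltW.
  rewrite -[leLHS]add0r lerD ?(ltW eta0)// -real_normK ?num_real// mulrC.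
  by rewrite ler_pdivlMr// expr2 ler_wpM2l// ltW.
rewrite mean_seqD mean_seq_cst// mean_seqZ lerD2l.
have -> : (l%:R * eta)^-1 = (l%:R ^+ 2 * eta)^-1 * l%:R by field; rewrite !gt_eqF.
by rewrite ler_wpM2l ?mean_count_sqr// invr_ge0 mulr_ge0 ?sqr_ge0// ltW.
Qed.

End Concentration.

(** * The limit of the unmatched fraction *)

Section MatchingRate.
Local Open Scope ring_scope.
Variables (R : realType) (bL bR : R) (C : 'M[R]_2).
Hypotheses (hbL : 0 <= bL <= 1) (hbR : 0 <= bR <= 1).
Hypothesis hC : forall x y : 'I_2, 0 <= C x y.

Let p := type_prob bL.
Let q := type_prob bR.
Let M := mean_demand_degree bL C.
Let dp : distribution p := type_prob_distribution hbL.
Let dq : distribution q := type_prob_distribution hbR.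

(** A common bound for the entries of [C], made positive by the summand 1. *)
Definition total_rate : R := 1 + \sum_x \sum_y C x y.
Let c := total_rate.

Let C_le x y : C x y <= c.
Proof.
rewrite /c /total_rate (bigD1 x)//= (bigD1 y)//=.
have s1 : 0 <= \sum_(i < 2 | i != y) C x i by apply: sumr_ge0.
have s2 : 0 <= \sum_(i < 2 | i != x) \sum_(y < 2) C i y.
  by apply: sumr_ge0 => i _; apply: sumr_ge0.
by lra.
Qed.

Let c1 : 1 <= c.
Proof. by rewrite lerDl; apply: sumr_ge0 => x _; apply: sumr_ge0. Qed.

Let c0 : 0 < c. Proof. exact: lt_le_trans c1. Qed.

Let M_ge0 y : 0 <= M y.
Proof. by apply: sumr_ge0 => x _; rewrite mulr_ge0// dp.1. Qed.

Definition supply_limit (z : 'I_2 -> R) (x : 'I_2) : R :=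
  expR (- \sum_y C x y * q y * expR (- z y)).

(* [F] in the variables [z y = M y * t y]. *)
Definition bethe (z : 'I_2 -> R) : R :=
  \sum_x p x * supply_limit z x - \sum_y q y * two_prob (z y).

Lemma F_bethe t1 t2 :
  F bL bR C t1 t2 = bethe (fun y => M y * (if y == 0 then t1 else t2)).
Proof.
rewrite /F /bethe -/p -/q -/M -[X in _ - X]dq.2 -addrA -sumrB; congr (_ + _).
by rewrite -sumrN; apply: eq_bigr => y _; rewrite /two_prob; ring.
Qed.

Lemma supply_limit_ge0 z x : 0 <= supply_limit z x.
Proof. exact: expR_ge0. Qed.

Lemma supply_limit_le1 z x : supply_limit z x <= 1.
Proof.
rewrite -[leRHS](@expR0 R) ler_expR oppr_le0; apply: sumr_ge0 => y _.
by rewrite !mulr_ge0 ?expR_ge0// dq.1.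
Qed.

Definition type_dev n (s : 'I_n -> 'I_2) : R :=
  \sum_x `|(count_mem x [seq s u | u <- enum 'I_n])%:R / n%:R - p x|.

Lemma type_dev_ge0 n (s : 'I_n -> 'I_2) : 0 <= type_dev s.
Proof. by apply: sumr_ge0. Qed.

Lemma type_average n (s : 'I_n -> 'I_2) (g : 'I_2 -> R) B : (0 < n)%N ->
  (forall x, `|g x| <= B) ->
  `|(\sum_u g (s u)) / n%:R - \sum_x p x * g x| <= B * type_dev s.
Proof.
move=> n0 gB.
have cntE (r : seq 'I_n) :
    \sum_(u <- r) g (s u) = \sum_x (count_mem x (map s r))%:R * g x.
  elim: r => [|u r IH]; first by rewrite big_nil big1// => x _; rewrite mul0r.
  rewrite big_cons IH (bigD1 (s u))//= [in RHS](bigD1 (s u))//= eqxx natrD mulrDl.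
  rewrite mul1r addrA; congr (_ + _); apply: eq_bigr => x /negbTE.
  by rewrite eq_sym => ->.
have -> : \sum_u g (s u) = \sum_(u <- enum 'I_n) g (s u) by rewrite big_enum.
rewrite cntE mulr_suml -sumrB.
apply: (le_trans (ler_norm_sum _ _ _)); rewrite mulr_sumr; apply: ler_sum => x _.
rewrite mulrAC -mulrBl normrM mulrC; exact: ler_wpM2r.
Qed.

Lemma mean_type_dev n (eta : R) : (0 < n)%N -> 0 < eta ->
  \sum_(s : {ffun 'I_n -> 'I_2}) (\prod_i p (s i)) * type_dev s <=
  2 * (eta + (n%:R * eta)^-1).
Proof.
move=> n0 eta0.
rewrite (mean_seq_ffun p n (fun w => \sum_x `|(count_mem x w)%:R / n%:R - p x|)).
rewrite mean_seq_sum big_ord_recl big_ord1.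
have h x := mean_count_dev dp x n0 eta0.
by have := h ord0; have := h (lift ord0 ord0); lra.
Qed.

Section FixedTypes.
Variables (n : nat) (s : 'I_n -> 'I_2).
Hypothesis n2c : 2 * c <= n%:R.

Let x := rate C s.

Let nR0 : 0 < n%:R :> R. Proof. by apply: lt_le_trans n2c; rewrite mulr_gt0. Qed.

Let c_le_n : c <= n%:R.
Proof. by apply: le_trans n2c; rewrite ler_peMl ?ler1n// ltW. Qed.

Let n0 : (0 < n)%N. Proof. by rewrite -(ltr0n R). Qed.

Let xE y u : x y u = C (s u) y / n%:R.
Proof.
rewrite /x /rate /edge_prob; apply/min_idPl; rewrite ler_pdivrMr// mul1r.
exact: le_trans (C_le (s u) y) c_le_n.
Qed.

Let x_le y u : x y u <= c / #|'I_n|%:R.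
Proof. by rewrite card_ord xE ler_pM2r ?invr_gt0. Qed.

Let x01 y u : 0 <= x y u <= 1.
Proof. by rewrite {1}xE divr_ge0// ge_min lexx orbT. Qed.

Let x12 y u : x y u <= 1 / 2.
Proof.
apply: (le_trans (x_le y u)); rewrite card_ord ler_pdivrMr//.
by rewrite div1r mulrC ler_pdivlMr// mulrC.
Qed.

Let sum_x y : \sum_u x y u <= c.
Proof.
apply: (@le_trans _ _ (\sum_(u < n) c / n%:R)).
  by apply: ler_sum => u _; have := x_le y u; rewrite card_ord.
rewrite sumr_const card_ord -[leLHS]mulr_natl mulrCA divff ?mulr1//.
by rewrite gt_eqF.
Qed.

Let T0 : (0 < #|'I_n|)%N. Proof. by rewrite card_ord. Qed.

Lemma unhit_limit_rate z u : unhit_limit q x z u = supply_limit z (s u).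
Proof.
congr (expR (- _)); apply: eq_bigr => y _; rewrite xE card_ord.
by field; rewrite gt_eqF.
Qed.

(** The exponents in the two bounds are the same function of the supply type, which lets the bounds
    meet. *)
Lemma leaf_rate_rate b u : expR (- leaf_rate q x b u) = supply_limit b (s u).
Proof. exact: unhit_limit_rate. Qed.

Lemma sum_rate_le y : \sum_u x y u <= M y + c * type_dev s.
Proof.
have -> : \sum_u x y u = (\sum_u C (s u) y) / n%:R.
  by rewrite mulr_suml; apply: eq_bigr => u _; exact: xE.
have -> : M y = \sum_t p t * C t y by apply: eq_bigr => t _; rewrite mulrC.
have := @type_average n s (fun t => C t y) c n0.
move=> /(_ (fun t => _)) h; have {h} := h _.
rewrite -lerBlDl => h; apply: le_trans (ler_norm _) (h _) => t.
by rewrite ger0_norm.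
Qed.

(** The empirical bound on [z y] may exceed [M y], so [z] is cut off at [M] before [F] is used. In
    [1 + c ^+ 2], the 1 is due to the average of [supply_limit] over the actual types and [c ^+ 2]
    to the cut-off. *)
Lemma deficiency_upper_types m (eta : R) K :
  (forall t1 t2, 0 <= t1 <= 1 -> 0 <= t2 <= 1 -> F bL bR C t1 t2 <= m) ->
  0 < eta -> (0 < K)%N -> (K.+2 <= n)%N ->
  (n%:R - mean_number q x n) / n%:R <= m + (1 + c ^+ 2) * type_dev s +
   (c * 2 * (eta + (n%:R^-1 + 6 / K%:R) / eta + (K%:R + c ^+ 2) / n%:R)
    + (K%:R + c ^+ 2) / n%:R + 2 * (\sum_y (q y)^-1 * expR (4 * c)) / K%:R).
Proof.
move=> Fm eta0 K0 Kn.
have := @deficiency_upper_bound R _ _ q x dq x01 c x12 sum_x x_le T0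
  (m + (1 + c ^+ 2) * type_dev s) eta K.
rewrite !card_ord; apply=> // z z01.
under eq_bigr do rewrite unhit_limit_rate.
pose z' y := Num.min (z y) (M y).
have z'0 y : 0 <= z' y by rewrite le_min M_ge0; have /andP[-> _] := z01 y.
have dist y : z y - z' y <= c * type_dev s.
  have /andP[_ zy] := z01 y; have := le_trans zy (sum_rate_le y).
  have cd : 0 <= c * type_dev s by rewrite mulr_ge0 ?type_dev_ge0// ltW.
  set D := c * type_dev s in cd *; rewrite /z' minEle; case: ifP => _ h; first by rewrite subrr.
  by rewrite lerBlDl.
have z'z y : z' y <= z y by rewrite ge_min lexx.
have bz' : bethe z' <= m.
  (* If [M y = 0], then [z' y = 0] and the quotient is 0 by convention, so [M y * t y = z' y] holds
     in all cases. *)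
  pose t y := z' y / M y.
  have t01 y : 0 <= t y <= 1.
    rewrite divr_ge0//=; have [M0|M0] := eqVneq (M y) 0.
      by rewrite /t M0 invr0 mulr0.
    by rewrite ler_pdivrMr ?mul1r ?ge_min ?lexx ?orbT// lt_neqAle eq_sym M0 M_ge0.
  have Mt y : M y * t y = z' y.
    have [M0|M0] := eqVneq (M y) 0; last by rewrite /t mulrCA divff ?mulr1.
    rewrite M0 mul0r; apply/eqP; rewrite eq_le z'0 /=.
    by rewrite ge_min M0 lexx orbT.
  have := Fm (t 0) (t 1) (t01 0) (t01 1); rewrite F_bethe.
  suff -> : bethe (fun y => M y * (if y == 0 then t 0 else t 1)) = bethe z' by [].
  congr bethe; apply/funext => y; rewrite -Mt.
  by case: y => -[|[|[]]]// i; rewrite /= -[LHS]/(M _ * t _); congr (M _ * t _); apply/val_inj.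
have -> : \sum_u supply_limit z (s u) - n%:R * \sum_y q y * two_prob (z y) =
    n%:R * ((\sum_u supply_limit z (s u)) / n%:R - \sum_y q y * two_prob (z y)).
  by field; rewrite gt_eqF.
rewrite ler_pM2l//.
have h1 : (\sum_u supply_limit z (s u)) / n%:R <= \sum_t p t * supply_limit z t + type_dev s.
  rewrite -lerBlDl -[leRHS]mul1r; apply: le_trans (ler_norm _) _.
  by apply: type_average => // t; rewrite ger0_norm ?supply_limit_ge0 ?supply_limit_le1.
have h2 : \sum_t p t * supply_limit z t <=
    \sum_t p t * supply_limit z' t + c ^+ 2 * type_dev s.
  rewrite -[X in _ + X]mul1r -[X in _ + X * _]dp.2 mulr_suml -big_split.
  apply: ler_sum => t _ /=; rewrite -mulrDr; apply: ler_wpM2l; first exact: dp.1.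
  have Cq0 y : 0 <= C t y * q y by rewrite mulr_ge0// dq.1.
  apply: le_trans (expRN_lipschitz _ (b := \sum_y C t y * q y * expR (- z' y)) _) _.
  - by apply: sumr_ge0 => y _; rewrite mulr_ge0 ?expR_ge0.
  - by apply: sumr_ge0 => y _; rewrite mulr_ge0 ?expR_ge0.
  rewrite lerD2l -sumrB; apply: (le_trans (ler_norm_sum _ _ _)).
  apply: (@le_trans _ _ (\sum_y q y * (c ^+ 2 * type_dev s))); last first.
    by rewrite -mulr_suml dq.2 mul1r.
  apply: ler_sum => y _; rewrite -mulrBr normrM ger0_norm// [C t y * _]mulrC -mulrA.
  apply: ler_wpM2l; first exact: dq.1.
  rewrite expr2 -mulrA; apply: ler_pM => //.
  apply: le_trans (dist y).
  have e1 := @expRN_lipschitz R (z' y) (z y) (z'0 y) (le_trans (z'0 y) (z'z y)).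
  rewrite distrC ger0_norm ?subr_ge0// in e1.
  have e2 : expR (- z y) <= expR (- z' y) by rewrite ler_expR lerN2.
  by rewrite ler0_norm ?subr_le0//; lra.
have h3 : \sum_y q y * two_prob (z' y) <= \sum_y q y * two_prob (z y).
  apply: ler_sum => y _; apply: ler_wpM2l; first exact: dq.1.
  exact: two_prob_homo.
by move: bz' h1 h2 h3; rewrite /bethe mulrDl mul1r; lra.
Qed.

Lemma deficiency_lower_types t1 t2 rho K :
  0 <= t1 -> 0 <= t2 -> c <= rho%:R -> (0 < K)%N ->
  F bL bR C t1 t2 - type_dev s - ((2 * K%:R + rho%:R + c ^+ 2) / n%:R + rho%:R ^+ 2 / K%:R)
  <= (n%:R - mean_number q x n) / n%:R.
Proof.
move=> t10 t20 c_rho K0; rewrite F_bethe; set b := (fun y => _).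
have b0 y : 0 <= b y by rewrite /b mulr_ge0//; case: ifP.
have rho0 : (0 < rho)%N by rewrite -(ltr0n R); apply: lt_le_trans c_rho.
have := deficiency_lower_bound dq x01 sum_x x_le T0 b0 c_rho rho0 K0.
rewrite !card_ord; under eq_bigr do rewrite leaf_rate_rate.
apply: le_trans; rewrite lerD2r.
have h1 : \sum_t p t * supply_limit b t - type_dev s <= (\sum_u supply_limit b (s u)) / n%:R.
  have h := @type_average n s (supply_limit b) 1 n0.
  have {h} : `|(\sum_u supply_limit b (s u)) / n%:R - \sum_t p t * supply_limit b t| <=
      1 * type_dev s.
    by apply: h => t; rewrite ger0_norm ?supply_limit_ge0 ?supply_limit_le1.
  by rewrite mul1r ler_norml => /andP[h _]; move: h; lra.
have h2 : \sum_y q y * expR (- b y) * (1 + b y) - 1 = - \sum_y q y * two_prob (b y).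
  rewrite -[X in _ - X]dq.2 -sumrB -sumrN; apply: eq_bigr => y _.
  by rewrite /two_prob; ring.
by move: h1 h2; rewrite /bethe; lra.
Qed.

End FixedTypes.

Let weight n (s : {ffun 'I_n -> 'I_2}) : R := \prod_i p (s i).

Let weight_ge0 n (s : {ffun 'I_n -> 'I_2}) : 0 <= weight s.
Proof. by apply: prodr_ge0 => i _; exact: dp.1. Qed.

Let sum_weight n : \sum_(s : {ffun 'I_n -> 'I_2}) weight s = 1.
Proof.
rewrite -(mean_seq_cst n 1 dp) -mean_seq_ffun; apply: eq_bigr => s _.
by rewrite mulr1.
Qed.

Lemma mean_deficiency n : (0 < n)%N ->
  1 - mean_max_matching bL bR C n / n%:R =
  \sum_(s : {ffun 'I_n -> 'I_2}) weight s *
    ((n%:R - mean_number q (rate C s) n) / n%:R).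
Proof.
move=> n0; have nR0 : n%:R != 0 :> R by rewrite pnatr_eq0 -lt0n.
rewrite mean_max_matchingE -[X in X - _](sum_weight n) mulr_suml -sumrB; apply: eq_bigr => s _.
by rewrite -/(weight s); field.
Qed.

Lemma exists_nat_div_le (b e : R) : 0 < e ->
  exists2 K, (0 < K)%N & forall k, (K <= k)%N -> b / k%:R <= e.
Proof.
move=> e0; exists (Num.bound `|b / e|).+1 => // k Kk.
have k0 : 0 < k%:R :> R by rewrite ltr0n; exact: leq_trans Kk.
rewrite ler_pdivrMr// mulrC -ler_pdivrMr//; apply: le_trans (ler_norm _) _.
apply/ltW/(lt_le_trans (archi_boundP (normr_ge0 _))); rewrite ler_nat.
exact: ltnW.
Qed.

Lemma deficiency_eventually_le m (e : R) :
  (forall t1 t2, 0 <= t1 <= 1 -> 0 <= t2 <= 1 -> F bL bR C t1 t2 <= m) -> 0 < e ->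
  exists n0, forall n, (n0 <= n)%N -> 1 - mean_max_matching bL bR C n / n%:R <= m + e.
Proof.
(* The parameters are chosen in the order [eta], [K], [n]. The total error is [a * eta], plus a term
   in [1 / K], plus [d / n]; each part is at most [e / 3]. *)
move=> Fm e0; pose a := 2 * (1 + c ^+ 2) + 2 * c.
have a0 : 0 < a by rewrite /a; have := sqr_ge0 c; have := c0; nra.
pose eta := e / (3 * a).
have eta0 : 0 < eta by rewrite divr_gt0// mulr_gt0.
pose C1 := \sum_y (q y)^-1 * expR (4 * c).
have e3 : 0 < e / 3 by rewrite divr_gt0.
have [K K0 hK] := exists_nat_div_le (12 * c / eta + 2 * C1) e3.
pose d := 2 * (1 + c ^+ 2) / eta + 2 * c / eta + 2 * c * (K%:R + c ^+ 2) + (K%:R + c ^+ 2).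
have [n1 n10 hn1] := exists_nat_div_le d e3.
have [n2 n20 hn2] := exists_nat_div_le (2 * c) ltr01.
exists (n1 + n2 + K.+2)%N => n nn.
have [nn1 nn2 nK] : [/\ (n1 <= n)%N, (n2 <= n)%N & (K.+2 <= n)%N].
  by clear - nn; split; lia.
have n0 : (0 < n)%N by exact: leq_trans nn1.
have nR0 : 0 < n%:R :> R by rewrite ltr0n.
have n2c : 2 * c <= n%:R.
  by have := hn2 n nn2; rewrite ler_pdivrMr// mul1r.
rewrite mean_deficiency//.
pose err : R := c * 2 * (eta + (n%:R^-1 + 6 / K%:R) / eta + (K%:R + c ^+ 2) / n%:R)
    + (K%:R + c ^+ 2) / n%:R + 2 * C1 / K%:R.
apply: (@le_trans _ _ (\sum_(s : {ffun 'I_n -> 'I_2}) weight s *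
    (m + err + (1 + c ^+ 2) * type_dev s))).
  apply: ler_sum => s _; apply: ler_wpM2l; first exact: weight_ge0.
  have := deficiency_upper_types s n2c Fm eta0 K0; rewrite -/C1.
  by rewrite addrAC; apply.
under eq_bigr do rewrite mulrDr.
rewrite big_split /= -mulr_suml sum_weight mul1r -addrA lerD2l.
under eq_bigr do rewrite mulrCA.
rewrite -mulr_sumr; have hdev := mean_type_dev n0 eta0.
have c20 : 0 <= 1 + c ^+ 2 by rewrite addr_ge0// sqr_ge0.
have h2 := ler_wpM2l c20 hdev.
apply: le_trans (lerD (lexx _) h2) _.
have hK1 := hK K (leqnn K); have hn1' : d / n%:R <= e / 3 by exact: hn1.
have -> : err + (1 + c ^+ 2) * (2 * (eta + (n%:R * eta)^-1)) =
    a * eta + (12 * c / eta + 2 * C1) / K%:R + d / n%:R.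
  by rewrite /err /a /d; field; rewrite !gt_eqF// ltr0n.
have -> : a * eta = e / 3 by rewrite /eta; field; rewrite gt_eqF.
by move: hK1 hn1'; lra.
Qed.

Lemma deficiency_eventually_ge t1 t2 (e : R) : 0 <= t1 -> 0 <= t2 -> 0 < e ->
  exists n0, forall n, (n0 <= n)%N ->
    F bL bR C t1 t2 - e <= 1 - mean_max_matching bL bR C n / n%:R.
Proof.
(* The error consists of [2 * eta], [rho%:R ^+ 2 / K%:R] and [d / n%:R], each at most [e / 3]. *)
move=> t10 t20 e0; pose eta := e / 6.
have eta0 : 0 < eta by rewrite divr_gt0.
have e3 : 0 < e / 3 by rewrite divr_gt0.
pose rho := Num.bound c.
have c_rho : c <= rho%:R by apply/ltW/archi_boundP/ltW.
have [K K0 hK] := exists_nat_div_le (rho%:R ^+ 2) e3.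
pose d := 2 / eta + (2 * K%:R + rho%:R + c ^+ 2).
have [n1 n10 hn1] := exists_nat_div_le d e3.
have [n2 n20 hn2] := exists_nat_div_le (2 * c) ltr01.
exists (n1 + n2)%N => n nn.
have [nn1 nn2] : (n1 <= n)%N /\ (n2 <= n)%N by clear - nn; split; lia.
have n0 : (0 < n)%N by exact: leq_trans nn1.
have nR0 : 0 < n%:R :> R by rewrite ltr0n.
have n2c : 2 * c <= n%:R.
  by have := hn2 n nn2; rewrite ler_pdivrMr// mul1r.
rewrite mean_deficiency//.
pose err : R := (2 * K%:R + rho%:R + c ^+ 2) / n%:R + rho%:R ^+ 2 / K%:R.
apply: (@le_trans _ _ (\sum_(s : {ffun 'I_n -> 'I_2}) weight s *
    (F bL bR C t1 t2 - err - type_dev s))); last first.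
  apply: ler_sum => s _; apply: ler_wpM2l; first exact: weight_ge0.
  by rewrite addrAC; exact: deficiency_lower_types.
under eq_bigr do rewrite mulrBr.
rewrite sumrB -mulr_suml sum_weight mul1r.
have hdev := mean_type_dev n0 eta0.
apply: le_trans (lerB (lexx _) hdev).
have hK1 := hK K (leqnn K); have hn1' : d / n%:R <= e / 3 by exact: hn1.
have : err + 2 * (eta + (n%:R * eta)^-1) = 2 * eta + rho%:R ^+ 2 / K%:R + d / n%:R.
  by rewrite /err /d; field; rewrite !gt_eqF// ltr0n.
have -> : 2 * eta = e / 3 by rewrite /eta; field.
move: hK1 hn1'; move: err (2 * (_ + _)) (d / _) (_ / K%:R) => A B D' E; lra.
Qed.

Lemma F_continuous : continuous (fun t : R * R => F bL bR C t.1 t.2).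
Proof.
have cst (a : R) : continuous (fun _ : R * R => a) by move=> t; exact: cvg_cst.
have prod (f g : R * R -> R) : continuous f -> continuous g ->
    continuous (fun t => f t * g t) by move=> cf cg t; apply: cvgM; [exact: cf|exact: cg].
have add (f g : R * R -> R) : continuous f -> continuous g ->
    continuous (fun t => f t + g t) by move=> cf cg t; apply: cvgD; [exact: cf|exact: cg].
have opp (f : R * R -> R) : continuous f -> continuous (fun t => - f t).
  by move=> cf t; apply: cvgN; exact: cf.
have ex (f : R * R -> R) : continuous f -> continuous (fun t => expR (f t)).
  move=> cf t; apply: (continuous_comp (cf t)); exact: continuous_expR.
have sum2 (f : 'I_2 -> R * R -> R) : (forall i, continuous (f i)) ->
    continuous (fun t => \sum_i f i t).
  move=> cf; rewrite (_ : (fun t => _) = (fun t => f ord0 t + f (lift ord0 ord0) t)).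
    exact: add.
  by apply/funext => t; rewrite big_ord_recl big_ord1.
have ct (y : 'I_2) : continuous (fun t : R * R => if y == 0 then t.1 else t.2).
  by case: (y == 0) => t; [exact: cvg_fst|exact: cvg_snd].
pose tt (y : 'I_2) (t : R * R) := if y == 0 then t.1 else t.2.
pose f (y : 'I_2) (t : R * R) := expR (- (M y * tt y t)).
have cf y : continuous (f y) by apply/ex/opp/prod; [exact: cst|exact: ct].
pose g (x : 'I_2) (t : R * R) := p x * expR (- \sum_y C x y * q y * f y t).
have cg x : continuous (g x).
  apply/prod/ex/opp; first exact: cst.
  by apply: (sum2 (fun y t => C x y * q y * f y t)) => y; apply: prod; [exact: cst|exact: cf].
pose h (y : 'I_2) (t : R * R) := q y * f y t * (1 + M y * tt y t).
have ch y : continuous (h y).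
  exact: (prod (fun t => q y * f y t) (fun t => 1 + M y * tt y t)
    (prod _ _ (cst _) (cf y)) (add _ _ (cst _) (prod _ _ (cst _) (ct y)))).
exact: (add (fun t => \sum_x g x t + \sum_y h y t) (fun=> - 1)
  (add _ _ (sum2 g cg) (sum2 h ch)) (cst _)).
Qed.

Lemma F_max : exists t1 t2, [/\ 0 <= t1 <= 1, 0 <= t2 <= 1 &
  forall r1 r2, 0 <= r1 <= 1 -> 0 <= r2 <= 1 -> F bL bR C r1 r2 <= F bL bR C t1 t2].
Proof.
pose A : set (R * R) := (`[0, 1] `*` `[0, 1])%classic.
have A0 : (A !=set0)%classic by exists (0, 0); split; rewrite /= in_itv /= lexx ler01.
have cA : compact A by apply: compact_setX; exact: segment_compact.
have cF : ({within A, continuous (fun t : R * R => F bL bR C t.1 t.2)})%classic.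
  exact/continuous_subspaceT/F_continuous.
have [[t1 t2] /set_mem[/= h1 h2] hm] := compact_EVT_max A0 cA cF.
exists t1, t2; split; [by move: h1; rewrite in_itv|by move: h2; rewrite in_itv|].
move=> r1 r2 hr1 hr2; apply: (hm (r1, r2)); apply/mem_set.
by split; rewrite /= in_itv.
Qed.

End MatchingRate.

Local Open Scope classical_set_scope.
Local Open Scope ring_scope.

Theorem corollary1 (R : realType) (bL bR : R) (C : 'M[R]_2)
    (hbL : 0 <= bL <= 1) (hbR : 0 <= bR <= 1)
    (hC : forall x y : 'I_2, 0 <= C x y) :
  (fun n : nat => mean_max_matching bL bR C n / n%:R) @ \oo
    --> matching_rate bL bR C /\
  exists m : R,
    is_maximum [set r : R | exists t1 t2 : R,
                  [/\ 0 <= t1 <= 1, 0 <= t2 <= 1 & r = F bL bR C t1 t2]] m /\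
    matching_rate bL bR C = 1 - m.
Proof.
have [t1 [t2 [ht1 ht2 Fm]]] := F_max bL bR C; set m := F bL bR C t1 t2 in Fm.
(* The upper bound on the unmatched fraction uses that [m] bounds [F] on the square, the lower bound
   that [m] is its value at [(t1, t2)]. *)
have cvg : (fun n => mean_max_matching bL bR C n / n%:R) @ \oo --> 1 - m.
  apply/cvgrPdist_le => e e0.
  have [n1 hn1] := deficiency_eventually_le hbL hbR hC Fm e0.
  have [n2 hn2] := deficiency_eventually_ge hbL hbR hC (andP ht1).1 (andP ht2).1 e0.
  near=> n.
  have := hn1 n; have := hn2 n; rewrite -/m.
  have -> : (n1 <= n)%N by near: n; exact: nbhs_infty_ge.
  have -> : (n2 <= n)%N by near: n; exact: nbhs_infty_ge.
  move: (_ / _) => a /(_ isT) h2 /(_ isT) h1.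
  by rewrite ler_norml; apply/andP; split; lra.
have rateE : matching_rate bL bR C = 1 - m by exact/cvg_lim.
split; first by rewrite rateE.
exists m; split=> //; split; first by exists t1, t2.
by move=> _ [r1 [r2 [hr1 hr2 ->]]]; exact: Fm.
Unshelve. all: by end_near.
Qed.
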